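(* Let $(\beta_{\mu,\boldsymbol{\nu}})_{\mu,\boldsymbol{\nu}}$ be a family of probability densities on $\mathbb{R}$, parameterized by their mean $\mu\in\mathbb{R}$ and a vector of additional parameters $\boldsymbol{\nu}$, and consider the penalty $$r_{\boldsymbol{\nu}}(\mu):=a(\boldsymbol{\nu})+\tfrac12 b(\boldsymbol{\nu})\mu^2,$$ where $a$ and $b$ are functions. Assume that all the following conditions are fulfilled: (a) the family is translation-invariant; (b) for all $\boldsymbol{\nu}$, $\beta_{0,\boldsymbol{\nu}}$ has finite entropy and belongs to $\mathcal{S}(\mathbb{R})$; (c) for all $\boldsymbol{\nu}$, $\mathcal{F}\beta_{0,\boldsymbol{\nu}}$ is nonzero everywhere; (i) $r_{\boldsymbol{\nu}}\in\mathcal{S}'(\mathbb{R})$ for all $\boldsymbol{\nu}$; (ii) the quotient $\mathcal{F}r_{\boldsymbol{\nu}}/\mathcal{F}\check{\beta}_{0,\boldsymbol{\nu}}$ belongs to $\mathcal{S}'(\mathbb{R})$ for all $\boldsymbol{\nu}$; (iii) $A_{\boldsymbol{\nu}}:=-\mathrm{Ent}(\beta_{0,\boldsymbol{\nu}})\,\mathbf{1}-\mathcal{F}^{-1}\left[\mathcal{F}r_{\boldsymbol{\nu}}/\mathcal{F}\check{\beta}_{0,\boldsymbol{\nu}}\right]$ does not depend on $\boldsymbol{\nu}$; let $A:=A_{\boldsymbol{\nu}}$; (iv) $A$ is such that $\int\exp(A)<\infty$. If $r$ corresponds to a KL-divergence with prior $\alpha$, then there exists $\sigma_0>0$ such that $$r_{\boldsymbol{\nu}}(\mu)=\frac{\mathrm{Var}(\beta_{0,\boldsymbol{\nu}})+\mu^2}{2\sigma_0^2}-\mathrm{Ent}(\beta_{0,\boldsymbol{\nu}})+\frac12\ln(2\pi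 e\sigma_0^2),\qquad \alpha(\theta)=\frac{1}{\sqrt{2\pi\sigma_0^2}}\exp\left(-\frac{\theta^2}{2\sigma_0^2}\right).$$
   Context: $\mathcal{S}(\mathbb{R})$ is the Schwartz class and $\mathcal{S}'(\mathbb{R})$ the space of tempered distributions. The Fourier transform is $(\mathcal{F}\varphi)(\xi)=\int_{\mathbb{R}}\varphi(x)e^{-i\xi x}\,dx$ on $\mathcal{S}(\mathbb{R})$, extended by duality to $\mathcal{S}'(\mathbb{R})$. $\check{\beta}(\theta):=\beta(-\theta)$, and $\mathbf{1}$ is the constant function equal to $1$. The family is translation-invariant if $\beta_{\mu,\boldsymbol{\nu}}(\theta)=\beta_{0,\boldsymbol{\nu}}(\theta-\mu)$ for all $\mu,\boldsymbol{\nu},\theta$. $\mathrm{Ent}(\beta)=-\int\ln(\beta)\,\beta$, and $\mathrm{Var}(\beta)$ is the variance of the distribution with density $\beta$. The quotient in (ii) is the product of the distribution $\mathcal{F}r_{\boldsymbol{\nu}}$ with the function $1/\mathcal{F}\check{\beta}_{0,\boldsymbol{\nu}}$. $\mathrm{KL}(\beta\|\alpha)=\int\ln(\beta(\theta)/\alpha(\theta))\,\beta(\theta)\,d\theta$. Priors $\alpha$ are probability distributions in $\mathcal{T}(\mathbb{R})=\{\alpha:\ln(\alpha)\in\mathcal{S}'(\mathbb{R})\}$. A penalty $r$ corresponds to a KL-divergence with prior $\alpha$ if there exists a constant $K\in\mathbb{R}$ such that $r_{\boldsymbol{\nu}}(\mu)+K=\mathrm{KL}(\beta_{\mu,\boldsymbol{\nu}}\|\alpha)$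 for all $\mu,\boldsymbol{\nu}$ (the constant $K$ being regarded as irrelevant).
   Formalization: The formula for r is proved up to an additive constant independent of μ and ν (literal equality fails: r+1 meets the same hypotheses, and the KL constant is ½ln(2πσ₀²), not ½ln(2πeσ₀²)); α equals the Gaussian almost everywhere; the set of ν is nonempty. *)

(* Defs.v *)
From HB Require Import structures.
From mathcomp Require Import all_boot all_order all_algebra.
From mathcomp Require Import complex.
From mathcomp Require Import all_classical all_reals all_analysis.
Set Implicit Arguments.
Unset Strict Implicit.
Unset Printing Implicit Defensive.
Import Order.TTheory GRing.Theory Num.Theory.
Import numFieldNormedType.Exports.
Local Open Scope classical_set_scope.
Local Open Scope complex_scope.
Local Open Scope ring_scope.

Section complex_valued.
Context {R : realType}.
Implicit Types (f : R -> R) (phi : R -> R[i]).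

Definition toC f : R -> R[i] := fun x => (f x)%:C.

(* Differentiation and integration of functions R -> R[i] are componentwise. *)
Definition csmooth phi : Prop :=
  forall (n : nat) (x : R),
    derivable (derive1n n (fun y => complex.Re (phi y))) x 1 /\
    derivable (derive1n n (fun y => complex.Im (phi y))) x 1.

Definition cderiven (n : nat) phi : R -> R[i] := fun x =>
  (derive1n n (fun y => complex.Re (phi y))) x +i*
  (derive1n n (fun y => complex.Im (phi y))) x.

Definition cintegral phi : R[i] :=
  Rintegral (@lebesgue_measure R) setT (fun x => complex.Re (phi x)) +i*
  Rintegral (@lebesgue_measure R) setT (fun x => complex.Im (phi x)).

Definition cis (t : R) : R[i] := cos t +i* sin t.

Definition fourier phi : R -> R[i] := fun xi =>
  cintegral (fun x => phi x * cis (- (xi * x))).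

Definition inv_fourier phi : R -> R[i] := fun x =>
  ((2 * pi)^-1)%:C * cintegral (fun xi => phi xi * cis (xi * x)).

End complex_valued.

Section tempered_distributions.
Context {R : realType}.
Implicit Types (f g : R -> R) (phi psi : R -> R[i]).

Definition schwartz_weight (i j : nat) phi (x : R) : R[i] :=
  (x ^+ i)%:C * cderiven j phi x.

Definition schwartz phi : Prop :=
  csmooth phi /\
  forall i j : nat, exists M : R, forall x : R,
    `|schwartz_weight i j phi x| <= M%:C.

Definition test_function phi : Prop :=
  csmooth phi /\ exists M : R, forall x : R, M < `|x| -> phi x = 0.

(* Functionals are total on R -> R[i]; only their values on Schwartz functions
   (or, for arbitrary distributions, on test functions) are meaningful, and
   [dist_eq] is the equality of S'(R). *)
Definition functional : Type := (R -> R[i]) -> R[i].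
Implicit Types T u : functional.

Definition dist_eq T T' : Prop := forall phi, schwartz phi -> T phi = T' phi.

(* S'(R): linear forms on S(R), continuous for the topology defined by the
   seminorms sup_x |x^i phi^(j)(x)| (for a linear form, continuity at 0). *)
Definition tempered T : Prop :=
  (forall (c : R[i]) phi psi, schwartz phi -> schwartz psi ->
     T (fun x => c * phi x + psi x) = c * T phi + T psi) /\
  (forall eps : R, 0 < eps -> exists (k : nat) (delta : R), 0 < delta /\
     forall phi, schwartz phi ->
       (forall (i j : nat) (x : R), (i <= k)%N -> (j <= k)%N ->
          `|schwartz_weight i j phi x| <= delta%:C) ->
       `|T phi| <= eps%:C).

(* A distribution [u], known through its values on test functions, belongs to
   S'(R) when it extends to an element of S'(R). The extension is unique up to
   [dist_eq] since test functions are dense in S(R). *)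
Definition tempered_extension u T : Prop :=
  tempered T /\ forall phi, test_function phi -> T phi = u phi.

Definition in_Sprime u : Prop := exists T, tempered_extension u T.

Definition Sprime_ext u : functional :=
  xget (fun=> 0) [set T | tempered_extension u T].

Definition regular_dist f : functional := fun phi =>
  cintegral (fun x => toC f x * phi x).

Definition fun_in_Sprime f : Prop :=
  locally_integrable setT f /\ in_Sprime (regular_dist f).

Definition fun_dist f : functional := Sprime_ext (regular_dist f).

Definition fourier_dist T : functional := fun phi => T (fourier phi).

Definition inv_fourier_dist T : functional := fun phi => T (inv_fourier phi).

(* Product of the distribution T with the function 1/g, for g smooth and
   nowhere zero, as a distribution on test functions. *)
Definition dist_quotient T (g : R -> R[i]) : functional := fun phi =>
  T (fun xi => phi xi / g xi).

End tempered_distributions.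

Section densities.
Context {R : realType}.
Implicit Types beta alpha : R -> R.

Definition density beta : Prop :=
  [/\ measurable_fun setT beta, (forall x, 0 <= beta x) &
      (\int[@lebesgue_measure R]_x (beta x)%:E = 1)%E].

(* Equality in the extended reals with a finite value forces integrability. *)
Definition has_mean beta (m : R) : Prop :=
  (\int[@lebesgue_measure R]_x (x * beta x)%:E = m%:E)%E.

(* Mathcomp's [ln] vanishes at 0, which gives the convention 0 ln 0 = 0. *)
Definition finite_entropy beta : Prop :=
  (@lebesgue_measure R).-integrable setT (fun x => (ln (beta x) * beta x)%:E).

Definition Ent beta : R :=
  - Rintegral (@lebesgue_measure R) setT (fun x => ln (beta x) * beta x).

Definition Mean beta : R :=
  Rintegral (@lebesgue_measure R) setT (fun x => x * beta x).

Definition Var beta : R :=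
  Rintegral (@lebesgue_measure R) setT
    (fun x => (x - Mean beta) ^+ 2 * beta x).

(* Extended-real valued; only used for [alpha] positive almost everywhere
   (see [prior]), so that the value of the integrand at alpha = 0 is
   irrelevant. *)
Definition KL beta alpha : \bar R :=
  (\int[@lebesgue_measure R]_x (ln (beta x / alpha x) * beta x)%:E)%E.

(* Probability densities alpha with ln(alpha) in S'(R). The almost everywhere
   positivity says that ln(alpha) is an almost everywhere finite function; it
   has to be required because [ln] is total. *)
Definition prior alpha : Prop :=
  [/\ density alpha, {ae @lebesgue_measure R, forall x, 0 < alpha x} &
      fun_in_Sprime (fun x => ln (alpha x))].

Definition reflected beta : R -> R := fun x => beta (- x).

(* F r / F (reflected beta0), as a distribution. *)
Definition fourier_quotient beta0 (r : R -> R) : functional :=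
  dist_quotient (fourier_dist (fun_dist r)) (fourier (toC (reflected beta0))).

Definition A_dist beta0 (r : R -> R) : functional := fun phi =>
  - (Ent beta0)%:C * fun_dist (fun=> 1) phi
  - inv_fourier_dist (Sprime_ext (fourier_quotient beta0 r)) phi.

(* The distribution [T] is a (real) function with integrable exponential. *)
Definition exp_integrable (T : functional) : Prop :=
  exists f : R -> R,
    [/\ fun_in_Sprime f, dist_eq T (fun_dist f) &
        (\int[@lebesgue_measure R]_x (expR (f x))%:E < +oo)%E].

End densities.

Section families.
Context {R : realType} {k : nat}.
(* [Nu] is the domain of the vector of additional parameters. *)
Implicit Types (Nu : set 'rV[R]_k) (beta : R -> 'rV[R]_k -> R -> R).

Definition translation_invariant Nu beta : Prop :=
  forall (mu : R) (nu : 'rV[R]_k) (theta : R), Nu nu ->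
    beta mu nu theta = beta 0 nu (theta - mu).

Definition penalty (a b : 'rV[R]_k -> R) : 'rV[R]_k -> R -> R :=
  fun nu mu => a nu + 2^-1 * b nu * mu ^+ 2.

Definition corresponds_to_KL Nu beta (r : 'rV[R]_k -> R -> R)
    (alpha : R -> R) : Prop :=
  exists K : R, forall (mu : R) (nu : 'rV[R]_k), Nu nu ->
    (r nu mu + K)%:E = KL (beta mu nu) alpha.

End families.

(* Main.v *)
Require Import Defs.
From HB Require Import structures.
From mathcomp Require Import all_boot all_order all_algebra.
From mathcomp Require Import complex.
From mathcomp Require Import all_classical all_reals all_analysis.
From mathcomp Require Import measurable_realfun ring lra.
Set Implicit Arguments.
Unset Strict Implicit.
Unset Printing Implicit Defensive.
Import Order.TTheory GRing.Theory Num.Theory.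
Import numFieldNormedType.Exports.
Local Open Scope classical_set_scope.
Local Open Scope ring_scope.

(* Write l = ln alpha and B = beta_{0,nu}. The KL identity says that
   int B(y) l(m + y) dy is a quadratic polynomial in m, and so is the
   same integral with l replaced by a quadratic q; matching the coefficients,
   h = l - q satisfies int B(y) h(m + y) dy = 0 for all m. Since
   max(l, 0) <= alpha has integral at most 1, int B(y) |h(m + y)| dy
   grows at most like 1 + m^2. Then h = 0 almost everywhere, by a Wiener-type
   argument on functions:
   - averaging h over short intervals makes it continuous;
   - the Fourier transform of B is smooth and nowhere zero, so any
     Psi(x) = int c(xi) cos((r xi + s) x) dxi with c a smooth enough bump is
     G * B for some rapidly decreasing G, hence is orthogonal to h;
   - some such Psi has nonzero integral, and dilating it gives an approximate
     identity.
   So alpha is the exponential of a quadratic q(x) = c0 + c2 x^2; having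
   integral 1, it is a centred Gaussian density, and the penalty follows by
   integrating q against the beta_{m,nu}. *)

(** * Integrals of real functions *)

Section real_integral.
Context {R : realType}.
Local Notation mu := (@lebesgue_measure R).
Implicit Types (f g : R -> R) (r t : R).

(** The obstacle is that [h] has no pointwise bound: the argument uses its local integrability and a
    quadratic growth that appears only after smoothing by B. Growth passes from the smoothed
    function to averages over intervals short enough to fit under a piece of B bounded below, which
    is why averaging precedes the Wiener argument. Quadratic growth also fixes the order of
    smoothness: the bump (1 - x^2)^6 gives kernels of size (1 + x^2)^-3, and their products with F
    stay integrable. Division by the transform of B is therefore needed only for functions with
    finitely many derivatives. Fourier inversion is avoided: everything is a real cosine with
    arbitrary phase, sine being the phase -pi/2, and the nonzero integral of Psi comes from a
    modulation. Each dilation r of Psi gets its own G, obtained by dividing on a compact frequency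
    window, with constants depending on r. This is harmless: orthogonality is an exact identity for
    each r, and the limit only needs a bound on the fixed Psi, since the dilation is moved onto
    F. *)

Definition integrableR f : Prop := mu.-integrable setT (EFin \o f).

Lemma integrableR_measurable f : integrableR f -> measurable_fun setT f.
Proof. by move=> /measurable_int/measurable_EFinP. Qed.

Lemma integrableR_dom g f : integrableR g -> measurable_fun setT f ->
  (forall x, `|f x| <= g x) -> integrableR f.
Proof.
move=> ig mf fg; apply: le_integrable ig => //; first exact/measurable_EFinP.
by move=> x _ /=; rewrite lee_fin (le_trans (fg x))// ler_norm.
Qed.

Lemma aeS (P Q : R -> Prop) : (forall x, P x -> Q x) ->
  {ae mu, forall x, P x} -> {ae mu, forall x, Q x}.
Proof.
move=> PQ; apply: filterS; first exact: (ae_filter_ringOfSetsType mu).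
exact: PQ.
Qed.

Lemma aeS2 (P Q S : R -> Prop) : (forall x, P x -> Q x -> S x) ->
  {ae mu, forall x, P x} -> {ae mu, forall x, Q x} -> {ae mu, forall x, S x}.
Proof.
move=> PQ; apply: filterS2; first exact: (ae_filter_ringOfSetsType mu).
exact: PQ.
Qed.

Lemma integrableR_ae f g : integrableR f -> measurable_fun setT g ->
  {ae mu, forall x, f x = g x} -> integrableR g.
Proof.
move=> fi mg fg; apply/integrableP; split; first exact/measurable_EFinP.
have /integrableP[mf] := fi; apply: le_lt_trans.
rewrite (@ae_eq_integral _ _ _ mu setT (fun x => `|(f x)%:E|)%E)//.
- by apply: measurableT_comp => //; exact/measurable_EFinP.
- exact: measurableT_comp.
- by apply: aeS fg => x /= -> _.
Qed.

Lemma integrableR_ext f g : f =1 g -> integrableR f -> integrableR g.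
Proof. by move=> /funext ->. Qed.

Lemma integrableRD f g : integrableR f -> integrableR g ->
  integrableR (fun x => f x + g x).
Proof. by move=> fi gi; have := integrableD measurableT fi gi. Qed.

Lemma integrableRB f g : integrableR f -> integrableR g ->
  integrableR (fun x => f x - g x).
Proof. by move=> fi gi; have := integrableB measurableT fi gi. Qed.

Lemma integrableRZl k f : integrableR f -> integrableR (fun x => k * f x).
Proof. by move=> fi; have := integrableZl measurableT k fi. Qed.

Lemma integrableR_norm f : integrableR f -> integrableR (fun x => `|f x|).
Proof. by move=> fi; have := integrable_norm fi. Qed.

Lemma integrableR_bounded f g M : integrableR f -> measurable_fun setT g ->
  (forall x, `|g x| <= M) -> integrableR (fun x => f x * g x).
Proof.
move=> fi mg gM; apply: (@integrableR_dom (fun x => M * `|f x|)).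
- exact/integrableRZl/integrableR_norm.
- by apply: measurable_funM => //; exact: integrableR_measurable.
- by move=> x; rewrite normrM mulrC ler_wpM2r.
Qed.

Lemma integralRE f : integrableR f ->
  (\int[mu]_x (f x)%:E = (\int[mu]_x f x)%R%:E)%E.
Proof. by move=> fi; rewrite /Rintegral fineK//; exact: integrable_fin_num. Qed.

Lemma RintegralT_eq f g : f =1 g -> \int[mu]_x f x = \int[mu]_x g x.
Proof. by move=> /funext ->. Qed.

Lemma le_RintegralT f g : integrableR f -> integrableR g ->
  (forall x, f x <= g x) -> \int[mu]_x f x <= \int[mu]_x g x.
Proof. by move=> fi gi fg; apply: le_Rintegral. Qed.

Lemma Rintegral_ae f g : measurable_fun setT f -> measurable_fun setT g ->
  {ae mu, forall x, f x = g x} -> \int[mu]_x f x = \int[mu]_x g x.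
Proof.
move=> mf mg fg; congr fine; apply: ae_eq_integral => //.
- exact/measurable_EFinP.
- exact/measurable_EFinP.
- by apply: aeS fg => x /= ->.
Qed.

(* As [+oo - +oo] is [-oo], a finite integral forces both parts to be finite. *)
Lemma integrableR_fin_num f : measurable_fun setT f ->
  (\int[mu]_x (f x)%:E)%E \is a fin_num -> integrableR f.
Proof.
move=> mf ff; apply/integrableP; split; first exact/measurable_EFinP.
by rewrite integral_fin_num_abs.
Qed.

Lemma cvg_RintegralT (f_ : nat -> R -> R) f g :
  (forall n, measurable_fun setT (f_ n)) -> measurable_fun setT f ->
  integrableR g -> (forall n x, `|f_ n x| <= g x) ->
  (forall x, f_ n x @[n --> \oo] --> f x) ->
  (\int[mu]_x f_ n x) @[n --> \oo] --> \int[mu]_x f x.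
Proof.
move=> mf_ mf gi fg ff.
have [|||fi _ cv] := @dominated_convergence _ _ _ mu _ measurableT
  (fun n x => (f_ n x)%:E) (EFin \o f) (EFin \o g)
  (fun n => proj2 (measurable_EFinP _ _) (mf_ n))
  (proj2 (measurable_EFinP _ _) mf) => //.
- by apply: aeW => x _; apply: cvg_EFin; [exact: nearW|exact: ff].
- by apply: aeW => x n _; rewrite /= lee_fin.
by apply: fine_cvg; rewrite -integralRE.
Qed.

Lemma integrableR_uncurry (F : R -> R -> R) a :
  measurable_fun setT (fun z : R * R => F z.1 z.2) ->
  (forall x, integrableR (F x)) ->
  (forall x, \int[mu]_y `|F x y| <= a x) -> integrableR a ->
  (mu \x mu)%E.-integrable setT (fun z : R * R => (F z.1 z.2)%:E).
Proof.
move=> mF iF Fa ia; apply/integrable12ltyP; first exact/measurable_EFinP.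
apply: (@le_lt_trans _ _ (\int[mu]_x (a x)%:E)%E); last first.
  by rewrite integralRE// ltry.
have mF' : measurable_fun setT (fun z : R * R => `|(F z.1 z.2)%:E|%E).
  by apply: measurableT_comp => //; exact/measurable_EFinP.
apply: ge0_le_integral => //=.
- by move=> x _; exact: integral_ge0.
- exact: (measurable_fun_fubini_tonelli_F (m2 := mu) _ mF').
- by apply/measurable_EFinP; exact: integrableR_measurable.
- move=> x _; rewrite (integralRE (integrableR_norm (iF x))) lee_fin.
  exact: Fa.
Qed.

(** The bound concerns the norms of the slices, not [F] itself: when a merely locally integrable
    function is averaged, no pointwise majorant of product form is at hand. *)
Lemma fubiniR (F : R -> R -> R) a :
  measurable_fun setT (fun z : R * R => F z.1 z.2) ->
  (forall x, integrableR (F x)) -> (forall y, integrableR (F ^~ y)) ->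
  (forall x, \int[mu]_y `|F x y| <= a x) -> integrableR a ->
  \int[mu]_x (\int[mu]_y F x y) = \int[mu]_y (\int[mu]_x F x y).
Proof.
move=> mF iF iF' Fa ia.
have /Fubini := integrableR_uncurry mF iF Fa ia.
move=> /(congr1 fine) /= E; rewrite /Rintegral.
transitivity (fine (\int[mu]_x \int[mu]_y (F x y)%:E)%E).
  by congr fine; apply: eq_integral => x _; rewrite -(integralRE (iF x)).
rewrite {}E; congr fine; apply: eq_integral => y _.
by rewrite (integralRE (iF' y)).
Qed.

(* The bound is product-shaped, so that every slice is integrable. *)
Lemma fubiniR_prod (F : R -> R -> R) a b :
  measurable_fun setT (fun z : R * R => F z.1 z.2) ->
  integrableR a -> integrableR b -> (forall x y, `|F x y| <= a x * b y) ->
  \int[mu]_x (\int[mu]_y F x y) = \int[mu]_y (\int[mu]_x F x y).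
Proof.
move=> mF ia ib Fab.
have iF x : integrableR (F x).
  apply: (integrableR_dom (integrableRZl (a x) ib)) => //.
  exact: (measurable_fun_pair2 x mF).
have iF' y : integrableR (F ^~ y).
  apply: (integrableR_dom (integrableRZl (b y) ia)) => [|x].
    exact: (measurable_fun_pair1 y mF).
  by rewrite mulrC.
apply: (@fubiniR _ (fun x => (\int[mu]_y b y) * a x)) => //.
- move=> x; rewrite mulrC -RintegralZl//.
  apply: le_RintegralT => //; first exact/integrableR_norm.
  exact/integrableRZl.
- exact: integrableRZl.
Qed.

Lemma measurable_affine (r t : R) :
  @measurable_fun _ _ (measurableTypeR R) (measurableTypeR R) setT
    (fun x => r * x + t).
Proof. by apply: measurable_funD => //; exact: measurable_funM. Qed.

(** The image of Lebesgue measure under the affine map, multiplied by [r], gives half-open intervals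
    their length, so it is Lebesgue measure by uniqueness. *)
Lemma ge0_integral_affine r t (F : R -> \bar R) : 0 < r ->
  measurable_fun setT F -> (forall x, 0 <= F x)%E ->
  (\int[mu]_x F x = r%:E * \int[mu]_x F (r * x + t)%R)%E.
Proof.
move=> r_gt0 mF F0; have mphi := measurable_affine r t.
have r0 : 0 <= r := ltW r_gt0.
have /= <- := @ge0_integral_pushforward _ _ _ _ _ _ mphi mu setT F measurableT
  mF (fun x _ => F0 x).
rewrite -(@ge0_integral_mscale _ _ _ _ setT measurableT (NngNum r0))//=.
  apply: eq_measure_integral => A mA _.
  apply: lebesgue_measure_unique => //= _ [[a b]] _ <-.
  rewrite /= /mscale /pushforward /=.
  have E : (fun x : R => r * x + t) @^-1` `]a, b] =
      `](a - t) / r, (b - t) / r]%classic.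
    apply/seteqP; split => x /=; rewrite !in_itv/=;
      by rewrite ltr_pdivrMr// ler_pdivlMr// lerBrDr ltrBlDr mulrC.
  rewrite [pushforward _ _ _](_ : _ = mu `](a - t) / r, (b - t) / r]);
    last by rewrite -E.
  rewrite !lebesgue_measure_itv/= !lte_fin ltr_pM2r ?invr_gt0// ltrD2r.
  case: ifP => _; last by rewrite mule0.
  rewrite -!EFinB -EFinM; congr EFin; field; exact: lt0r_neq0.
Qed.

Lemma integrableR_affine r t f : 0 < r -> integrableR f ->
  integrableR (fun x => f (r * x + t)).
Proof.
move=> r0 fi; have mf := integrableR_measurable fi.
have mft : measurable_fun setT (fun x => f (r * x + t)).
  exact: (measurableT_comp mf (measurable_affine r t)).
apply/integrableP; split; first exact/measurable_EFinP.
have /integrableP[_] := fi.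
rewrite (@ge0_integral_affine r t)//; last first.
  by apply: measurableT_comp => //; exact/measurable_EFinP.
apply: contraTT; rewrite -!leNgt !leye_eq => /eqP ->.
by rewrite gt0_muley// lte_fin.
Qed.

Lemma Rintegral_affine r t f : 0 < r -> integrableR f ->
  \int[mu]_x f x = r * \int[mu]_x f (r * x + t).
Proof.
move=> r0 fi; have mf := integrableR_measurable fi.
have fti := integrableR_affine t r0 fi.
have mEf : measurable_fun setT (EFin \o f) by exact/measurable_EFinP.
have E g : integrableR g ->
    \int[mu]_x g x = fine (\int[mu]_x (EFin \o g)^\+ x)%E
                    - fine (\int[mu]_x (EFin \o g)^\- x)%E.
  move=> gi; rewrite /Rintegral integralE fineB//.
  - exact: integrable_pos_fin_num.
  - exact: integrable_neg_fin_num.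
have F X : X \is a fin_num -> fine (r%:E * X)%E = r * fine X.
  by move=> fX; rewrite fineM.
rewrite !E// mulrBr; congr (_ - _).
- rewrite (@ge0_integral_affine r t)//; last exact: measurable_funepos.
  rewrite -F; last exact: integrable_pos_fin_num.
  by congr (fine (_ * _)%E); apply: eq_integral => x _; rewrite !funeposE.
- rewrite (@ge0_integral_affine r t)//; last exact: measurable_funeneg.
  rewrite -F; last exact: integrable_neg_fin_num.
  by congr (fine (_ * _)%E); apply: eq_integral => x _; rewrite !funenegE.
Qed.

Lemma integrableR_shift t f : integrableR f -> integrableR (fun x => f (x + t)).
Proof.
move=> /(integrableR_affine t ltr01); apply: integrableR_ext => x.
by rewrite mul1r.
Qed.

Lemma Rintegral_shift t f : integrableR f ->
  \int[mu]_x f (x + t) = \int[mu]_x f x.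
Proof.
move=> /(Rintegral_affine t ltr01) ->; rewrite mul1r.
by apply: RintegralT_eq => x; rewrite mul1r.
Qed.

End real_integral.

(** * Cosine transforms of class C^n *)

Section smooth.
Context {R : realType}.
Local Notation mu := (@lebesgue_measure R).
Implicit Types (f g w : R -> R) (x y z : R) (n : nat).

Definition derives f f' : Prop := forall x, is_derive x (1 : R) f (f' x).

Lemma derives_ext f f' g' : f' =1 g' -> derives f f' -> derives f g'.
Proof. by move=> fg df x; rewrite -fg. Qed.

Lemma derivesD f f' g g' : derives f f' -> derives g g' ->
  derives (fun x => f x + g x) (fun x => f' x + g' x).
Proof. by move=> df dg x; exact: is_deriveD. Qed.

Lemma derivesM f f' g g' : derives f f' -> derives g g' ->
  derives (fun x => f x * g x) (fun x => f' x * g x + f x * g' x).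
Proof.
move=> df dg x; apply: (is_derive_eq (is_deriveM (df x) (dg x))).
by rewrite /GRing.scale/=; ring.
Qed.

Lemma derivesV f f' : (forall x, f x != 0) -> derives f f' ->
  derives (fun x => (f x)^-1) (fun x => - f' x * ((f x)^-1 * (f x)^-1)).
Proof.
move=> f0 df x; apply: (is_derive_eq (is_deriveV (f0 x) (df x))).
by rewrite /GRing.scale/= -exprVn expr2; ring.
Qed.

Lemma derives_cst k : derives (fun=> k) (fun=> 0).
Proof. by move=> x; exact: is_derive_cst. Qed.

Lemma derives_id : derives (fun x => x) (fun=> 1).
Proof. by move=> x; exact: is_derive_id. Qed.

Lemma derives_affine k l : derives (fun x => k * x + l) (fun=> k).
Proof.
apply: derives_ext (derivesD (derivesM (derives_cst k) derives_id) (derives_cst l)).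
by move=> x; ring.
Qed.

Lemma derives_comp f f' g g' : derives f f' -> derives g g' ->
  derives (fun x => f (g x)) (fun x => f' (g x) * g' x).
Proof. by move=> df dg x; exact: is_derive1_comp. Qed.

Lemma derives_continuous f f' : derives f f' -> continuous f.
Proof.
move=> df x; apply/differentiable_continuous/derivable1_diffP.
exact: (@ex_derive _ _ _ _ _ _ _ (df x)).
Qed.

Lemma derives_derive1 f f' x : derives f f' -> derive1 f x = f' x.
Proof. by move=> df; rewrite derive1E; exact: (@derive_val _ _ _ _ _ _ _ (df x)). Qed.

(** Each order carries an explicit derivative, so that closure under products and inverses is an
    induction on [n] along the Leibniz formulas. *)
Fixpoint Cn n f : Prop :=
  if n is n'.+1 then exists2 f', derives f f' & Cn n' f' else continuous f.

Lemma Cn_continuous n f : Cn n f -> continuous f.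
Proof. by case: n => // n [f' /derives_continuous]. Qed.

Lemma CnS n f : Cn n.+1 f -> Cn n f.
Proof.
elim: n f => [|n IH] f; first exact: Cn_continuous.
by move=> [f' df /IH f'n]; exists f'.
Qed.

Lemma Cn_cst n k : Cn n (fun=> k).
Proof.
elim: n k => [|n IH] k /=; first by move=> x; exact: cvg_cst.
by exists (fun=> 0) => //; exact: derives_cst.
Qed.

Lemma Cn_affine n k l : Cn n (fun x => k * x + l).
Proof.
case: n => [|n] /=; first exact: derives_continuous (derives_affine k l).
by exists (fun=> k); [exact: derives_affine|exact: Cn_cst].
Qed.

Lemma CnD n f g : Cn n f -> Cn n g -> Cn n (fun x => f x + g x).
Proof.
elim: n f g => [|n IH] f g /=; first by move=> cf cg x; apply: cvgD; [exact: cf|exact: cg].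
move=> [f' df f'n] [g' dg g'n]; exists (fun x => f' x + g' x).
  exact: derivesD.
exact: IH.
Qed.

Lemma CnM n f g : Cn n f -> Cn n g -> Cn n (fun x => f x * g x).
Proof.
elim: n f g => [|n IH] f g; first by move=> cf cg x; apply: cvgM; [exact: cf|exact: cg].
move=> fn gn; have [f' df f'n] := fn; have [g' dg g'n] := gn.
exists (fun x => f' x * g x + f x * g' x); first exact: derivesM.
by apply: CnD; apply: IH => //; exact: CnS.
Qed.

Lemma CnN n f : Cn n f -> Cn n (fun x => - f x).
Proof.
move=> fn; have := CnM (Cn_cst n (-1)) fn.
by under eq_fun do rewrite mulN1r.
Qed.

Lemma CnV n f : (forall x, f x != 0) -> Cn n f -> Cn n (fun x => (f x)^-1).
Proof.
move=> f0; elim: n => [|n IH]; first by move=> cf x; apply: cvgV; [exact: f0|exact: cf].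
move=> fn; have [f' df f'n] := fn.
exists (fun x => - f' x * ((f x)^-1 * (f x)^-1)); first exact: derivesV.
by apply: CnM; [exact: CnN|apply: CnM; apply: IH; exact: CnS].
Qed.

Lemma Cn_comp_affine n f k l : Cn n f -> Cn n (fun x => f (k * x + l)).
Proof.
elim: n f => [|n IH] f /=.
  move=> cf x; apply: (@continuous_comp _ _ _ (fun x => k * x + l)) => //.
    exact: (derives_continuous (derives_affine k l)).
  exact: cf.
move=> [f' df f'n]; exists (fun x => f' (k * x + l) * k).
  exact: derives_comp df (derives_affine k l).
by apply: CnM; [exact: IH|exact: Cn_cst].
Qed.

Lemma cosDpihalf x : cos (x + pi / 2) = - sin x.
Proof. by rewrite cosD cos_pihalf sin_pihalf mulr0 sub0r mulr1. Qed.

(** Writing the derivative as a cosine with advanced phase keeps a single family of functions stable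
    under differentiation; the inductions on smoothness below quantify over the phase for this
    reason. *)
Lemma derives_cos y z :
  derives (fun x => cos (x * y + z)) (fun x => y * cos (x * y + (z + pi / 2))).
Proof.
apply: (@derives_ext _ (fun x => - sin (y * x + z) * y)).
  by move=> x; rewrite addrA cosDpihalf mulrC (mulrC y x).
under eq_fun do rewrite mulrC.
exact: derives_comp (fun x => is_derive_cos x) (derives_affine y z).
Qed.

Lemma continuous_cos_affine y z : continuous (fun x => cos (x * y + z)).
Proof. exact: derives_continuous (derives_cos y z). Qed.

(** Integrable moments of every order are what repeated differentiation under the integral of a
    cosine transform consumes; no pointwise decay is involved. *)
Definition rapid w : Prop :=
  measurable_fun setT w /\ forall n, integrableR (fun y => y ^+ n * w y).

Lemma rapid_integrableR w : rapid w -> integrableR w.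
Proof. by move=> [_ /(_ 0%N)]; apply: integrableR_ext => x; rewrite mul1r. Qed.

Lemma rapidX w : rapid w -> rapid (fun y => y * w y).
Proof.
move=> [mw iw]; split=> [|n]; first exact: measurable_funM.
by apply: integrableR_ext (iw n.+1) => x; rewrite exprSr mulrA.
Qed.

Lemma measurable_cos_affine y z : measurable_fun setT (fun x => cos (x * y + z)).
Proof. by apply: continuous_measurable_fun; exact: continuous_cos_affine. Qed.

Lemma measurable_cos_affine2 x z : measurable_fun setT (fun y => cos (x * y + z)).
Proof. under eq_fun do rewrite mulrC; exact: measurable_cos_affine. Qed.

Lemma integrableR_cos w x z : integrableR w ->
  integrableR (fun y => w y * cos (x * y + z)).
Proof.
move=> iw; apply: (@integrableR_bounded _ _ _ 1) => //.
- exact: measurable_cos_affine2.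
- by move=> y; exact: cos_max.
Qed.

Lemma derives_cos_transform w z : rapid w ->
  derives (fun x => \int[mu]_y (w y * cos (x * y + z)))
          (fun x => \int[mu]_y (y * w y * cos (x * y + (z + pi / 2)))).
Proof.
move=> wr x; have iw := rapid_integrableR wr.
have iyw := integrableR_norm (rapid_integrableR (rapidX wr)).
have dw y : derives (fun x => w y * cos (x * y + z))
                    (fun x => y * w y * cos (x * y + (z + pi / 2))).
  move=> x'; have := derivesM (derives_cst (w y)) (derives_cos y z) x'.
  by rewrite mul0r add0r mulrCA mulrA.
have pE y x' : partial1of2 (fun x y => w y * cos (x * y + z)) x' y =
    y * w y * cos (x' * y + (z + pi / 2)).
  exact: (derives_derive1 x' (dw y)).
have I : `]x - 1, x + 1[%classic x by rewrite /= in_itv/= ltrBlDr !ltrDl !ltr01.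
apply: DeriveDef.
  apply: (@derivable_under_integral _ _ _ mu
    (fun x y => w y * cos (x * y + z)) _ _ _ _ _ I _ _ (fun y => `|y * w y|)) => //.
  - by move=> x' _; exact: integrableR_cos.
  - by move=> x' y _ _; rewrite pE normrM ler_piMr// cos_max.
rewrite -derive1E (@differentiation_under_integral _ _ _ mu
    (fun x y => w y * cos (x * y + z)) _ _ _ _ _ I _ _ (fun y => `|y * w y|)) => //.
- by apply: RintegralT_eq => y; rewrite pE.
- by move=> x' _; exact: integrableR_cos.
- by move=> x' y _ _; rewrite pE normrM ler_piMr// cos_max.
Qed.

Lemma Cn_cos_transform n w z : rapid w ->
  Cn n (fun x => \int[mu]_y (w y * cos (x * y + z))).
Proof.
elim: n w z => [|n IH] w z wr /=.
  exact: derives_continuous (derives_cos_transform z wr).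
exists (fun x => \int[mu]_y (y * w y * cos (x * y + (z + pi / 2)))).
  exact: derives_cos_transform.
exact/IH/rapidX.
Qed.

Lemma continuous_integrable_itv f (u v : R) : continuous f ->
  mu.-integrable `[u, v] (EFin \o f).
Proof.
move=> cf; apply: continuous_compact_integrable; first exact: segment_compact.
exact: continuous_subspaceT.
Qed.

Lemma derives_oo_LR f f' (u v : R) : derives f f' ->
  derivable_oo_LRcontinuous f u v.
Proof.
move=> df; split.
- by move=> x _; exact: (@ex_derive _ _ _ _ _ _ _ (df x)).
- by apply: cvg_at_right_filter; exact: (derives_continuous df).
- by apply: cvg_at_left_filter; exact: (derives_continuous df).
Qed.

Lemma derives_sqr_pow n : derives (fun x => (1 - x * x) ^+ n.+1)
  (fun x => (1 - x * x) ^+ n * (- (2 * n.+1%:R) * x)).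
Proof.
have d1 : derives (fun x : R => 1 - x * x) (fun x => - (2 * x)).
  have := derivesD (derives_cst 1) (derivesM (derives_affine (-1) 0) (derives_affine 1 0)).
  under [X in derives X _ -> _]eq_fun do rewrite !addr0 mul1r mulN1r mulNr.
  by apply: derives_ext => x; ring.
elim: n => [|n IH].
  under eq_fun do rewrite expr1.
  by apply: derives_ext d1 => x; rewrite expr0; ring.
have := derivesM d1 IH; under [X in derives X _ -> _]eq_fun do rewrite -exprS.
by apply: derives_ext => x; rewrite -!natr1 !exprS; ring.
Qed.

(* Each integration by parts gains a factor [1 / y]; the boundary terms vanish
   because of the weight [(1 - x^2)^n]. *)
Lemma bump_cos_decay n g : Cn n g -> exists C, forall y z,
  `|y| ^+ n *
    `|\int[mu]_(x in `[-1, 1]) ((1 - x * x) ^+ n * g x * cos (x * y + z))| <= C.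
Proof.
elim: n g => [|n IH] g.
  move=> /= cg; exists (\int[mu]_(x in `[-1, 1]) `|g x|) => y z.
  rewrite expr0 mul1r; apply: (le_trans (le_normr_Rintegral _ _)) => //.
    apply: continuous_integrable_itv; apply: (@CnM 0 _ _ (CnM _ _)) => //=.
    - by move=> x; exact: cvg_cst.
    - exact: continuous_cos_affine.
  apply: le_Rintegral => //.
  - apply: integrable_norm; apply: continuous_integrable_itv.
    apply: (@CnM 0 _ _ (CnM _ _)) => //=; first by move=> x; exact: cvg_cst.
    exact: continuous_cos_affine.
  - by apply: integrable_norm; exact: continuous_integrable_itv.
  - by move=> x _; rewrite expr0 mul1r normrM ler_piMr// cos_max.
move=> gn; have [g' dg g'n] := gn.
(* The derivative of (1 - x^2)^(n+1) g is (1 - x^2)^n h: one power of the weight is spent and one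
   order of smoothness of [g] is lost, which matches the induction. The [+ 0] fits the shape of
   [Cn_affine]. *)
pose h x := (- (2 * n.+1%:R) * x + 0) * g x + (1 - x * x) * g' x.
have hn : Cn n h.
  apply: CnD; apply: CnM => //; [exact: Cn_affine|exact: CnS|].
  have := CnD (Cn_cst n 1) (CnM (Cn_affine n (-1) 0) (Cn_affine n 1 0)).
  by under [X in Cn _ X -> _]eq_fun do rewrite !addr0 mul1r mulN1r mulNr.
have [C HC] := IH h hn; exists C => y z.
pose F x := (1 - x * x) ^+ n.+1 * g x.
have dF : derives F (fun x => (1 - x * x) ^+ n * h x).
  apply: derives_ext (derivesM (derives_sqr_pow n) dg) => x.
  by rewrite /h exprS; ring.
have cF' : continuous (fun x => (1 - x * x) ^+ n * h x).
  apply: (@CnM 0) => //; last exact: Cn_continuous hn.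
  case: n {IH gn g'n hn HC F dF h} => [|n] /=; first by move=> x; exact: cvg_cst.
  exact: derives_continuous (derives_sqr_pow n).
have dG : derives (fun x => cos (x * y + (z - pi / 2)))
                  (fun x => y * cos (x * y + z)).
  apply: derives_ext (derives_cos y (z - pi / 2)) => x.
  by rewrite subrK.
have := @Rintegration_by_parts _ F (fun x => cos (x * y + (z - pi / 2)))
  (fun x => (1 - x * x) ^+ n * h x) (fun x => y * cos (x * y + z)) (-1) 1.
rewrite {1 2 3 4}/F.
move=> /(_ _ (continuous_subspaceT cF') (derives_oo_LR _ _ dF) _ _
  (derives_oo_LR _ _ dG) _).
rewrite /F mulN1r opprK mul1r subrr expr0n /= !mul0r subrr sub0r => E.
rewrite exprS -mulrA mulrCA -normrM -RintegralZl//; last first.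
  apply: continuous_integrable_itv.
  apply: (@CnM 0 F) => //; first exact: derives_continuous dF.
  exact: continuous_cos_affine.
rewrite (_ : \int[mu]_(x in `[-1, 1]) _ =
    - \int[mu]_(x in `[-1, 1]) ((1 - x * x) ^+ n * h x * cos (x * y + (z - pi / 2)))).
  by rewrite normrN; exact: HC.
rewrite -E.
- by apply: eq_Rintegral => x _; rewrite mulrCA.
- by rewrite -subr_gt0 opprK addr_gt0.
- by move=> x _; exact: (derives_derive1 x dF).
- apply: continuous_subspaceT; apply: (@CnM 0); first by move=> x; exact: cvg_cst.
  exact: continuous_cos_affine.
- by move=> x _; exact: (derives_derive1 x dG).
Qed.

End smooth.

(** * Deconvolution against a rapidly decreasing kernel *)

Section tauberian.
Context {R : realType}.
Local Notation mu := (@lebesgue_measure R).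
Implicit Types (a f g w : R -> R) (r s x y z : R) (n : nat).

(* The square of the Japanese bracket; [jweightD] is Peetre's inequality. *)
Definition jweight x : R := 1 + x * x.

Lemma jweight_ge1 x : 1 <= jweight x.
Proof. by rewrite lerDl -expr2 sqr_ge0. Qed.

Lemma jweight_gt0 x : 0 < jweight x.
Proof. exact: lt_le_trans (jweight_ge1 x). Qed.

Lemma continuous_jweight : continuous jweight.
Proof.
move=> x; apply: cvgD; first exact: cvg_cst.
by apply: cvgM; exact: cvg_id.
Qed.

Lemma continuous_jweightV : continuous (fun x => (jweight x)^-1).
Proof.
move=> x; apply: cvgV; last exact: continuous_jweight.
by rewrite gt_eqF// jweight_gt0.
Qed.

Lemma measurable_jweightV : measurable_fun setT (fun x => (jweight x)^-1).
Proof. by apply: continuous_measurable_fun; exact: continuous_jweightV. Qed.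

Lemma jweightD x y : jweight (x + y) <= 2 * jweight x * jweight y.
Proof.
rewrite -subr_ge0.
have -> : 2 * jweight x * jweight y - jweight (x + y) =
  1 + (x - y) ^+ 2 + 2 * (x * y) ^+ 2 by rewrite /jweight; ring.
by rewrite !addr_ge0 ?sqr_ge0// mulr_ge0 ?sqr_ge0.
Qed.

(** Each half-line contributes the arctangent integral pi/2, the left one by reflection. *)
Lemma integrableR_jweightV : integrableR (fun x => (jweight x)^-1).
Proof.
apply/integrableP; split.
  by apply/measurable_EFinP; exact: measurable_jweightV.
have j0 x : 0 <= (jweight x)^-1 by rewrite invr_ge0 ltW// jweight_gt0.
under eq_integral => x _ do rewrite /= ger0_norm//.
have mE D : measurable_fun D (fun x => ((jweight x)^-1)%:E).
  by apply/measurable_EFinP; apply: measurable_funTS; exact: measurable_jweightV.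
have I0 : (\int[mu]_(x in `[0%R, +oo[) ((jweight x)^-1)%:E = (pi / 2)%:E)%E.
  rewrite -integral0y_oneDsqr; apply: eq_integral => x _.
  by rewrite /oneDsqr /jweight expr2.
have I1 : (\int[mu]_(x in `]-oo, 0%R]) ((jweight x)^-1)%:E = (pi / 2)%:E)%E.
  rewrite -I0 ge0_integration_by_substitution0; [|exact: mE|by []].
  by apply: eq_integral => x _; rewrite /jweight mulrNN.
rewrite -(setUv `[0%R, +oo[) ge0_integral_setU//=; last 4 first.
- exact: measurableC.
- exact: mE.
- by move=> x _; rewrite lee_fin.
- by rewrite disj_set2E setICr.
rewrite I0 setCitvr; apply: (@le_lt_trans _ _ ((pi / 2)%:E + (pi / 2)%:E)%E).
  rewrite leeD2l// -I1; apply: ge0_subset_integral => //.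
  - exact: mE.
  - by move=> x _; rewrite lee_fin.
  - by move=> x /=; rewrite !in_itv/= => /ltW.
by rewrite -EFinD ltry.
Qed.

Lemma integrableR_jweight_dom f k : measurable_fun setT f ->
  (forall x, `|f x| <= k * (jweight x)^-1) -> integrableR f.
Proof.
move=> mf fk; apply: (integrableR_dom (integrableRZl k integrableR_jweightV)) => //.
Qed.

(** The exponent 6 allows six integrations by parts, hence decay [jweight^-3]. One factor pays for
    the quadratic growth of the function tested, and the remaining [jweight^-2] is integrable. The
    even exponent also makes the bump nonnegative. *)
Definition bump x : R := (1 - x * x) ^+ 6 * \1_`[-1, 1] x.

Lemma bumpE f : (fun x => bump x * f x) = (fun x => (1 - x * x) ^+ 6 * f x) \_ `[-1, 1].
Proof.
apply/funext => x; rewrite patchE /bump indicE.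
by case: ifP => _; rewrite ?mulr1// mulr0 mul0r.
Qed.

Lemma continuous_bump_poly n : continuous (fun x : R => (1 - x * x) ^+ n).
Proof.
case: n => [|n]; first by move=> x; exact: cvg_cst.
exact: derives_continuous (derives_sqr_pow n).
Qed.

Lemma integrableR_bump f : continuous f -> integrableR (fun x => bump x * f x).
Proof.
move=> cf; rewrite /integrableR bumpE -restrict_EFin.
apply: (iffLR (integrable_mkcond _ _)) => //.
apply: continuous_integrable_itv.
by apply: (@CnM _ 0) => //; exact: continuous_bump_poly.
Qed.

Lemma integrableR_bump1 : integrableR bump.
Proof.
have c1 : continuous (fun _ : R => 1 : R) by move=> x; exact: cvg_cst.
by apply: integrableR_ext (integrableR_bump c1) => x; rewrite mulr1.
Qed.

Lemma Rintegral_bump f :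
  \int[mu]_x (bump x * f x) = \int[mu]_(x in `[-1, 1]) ((1 - x * x) ^+ 6 * f x).
Proof. by rewrite [RHS]Rintegral_mkcond -bumpE. Qed.

(** The decay estimate of order 6 controls large [y] and that of order 0 controls small [y].
    Uniformity in the phase [z] matters: later the phase varies with the point of evaluation. *)
Lemma bump_cos_jweight g : (forall n, Cn n g) -> exists C, forall y z,
  `|\int[mu]_x (bump x * g x * cos (x * y + z))| <= C * (jweight y)^-1 ^+ 3.
Proof.
move=> gn; have [C HC] := bump_cos_decay (gn 6%N).
have [C0 HC0] := @bump_cos_decay R 0 (fun x => (1 - x * x) ^+ 6 * g x)
  (CnM (@continuous_bump_poly 6 : Cn 0 _) (gn 0%N)).
exists (4 * (C + C0)) => y z.
under RintegralT_eq do rewrite -mulrA.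
rewrite Rintegral_bump.
under eq_Rintegral do rewrite mulrA.
move: (HC y z) (HC0 y z); rewrite expr0 mul1r.
under [X in _ -> `|X| <= _ -> _]eq_Rintegral do rewrite expr0 mul1r.
set J := (X in _ -> X <= _ -> _) => H6 H0.
rewrite exprVn ler_pdivlMr ?exprn_gt0 ?jweight_gt0//.
have y2 : y * y = `|y| ^+ 2 by rewrite -normrX ger0_norm ?sqr_ge0 ?expr2.
apply: (@le_trans _ _ (J * (4 * (1 + `|y| ^+ 6)))); last first.
  by rewrite mulrCA ler_pM2l// mulrDr mulr1 addrC lerD// mulrC.
apply: ler_wpM2l; first exact: normr_ge0.
rewrite /jweight y2 -subr_ge0.
(* This is (1 + u)^3 <= 4 (1 + u^3) for u = y^2 >= 0, and explains the factor 4 in the constant. *)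
have -> : 4 * (1 + `|y| ^+ 6) - (1 + `|y| ^+ 2) ^+ 3 =
  3 * ((1 + `|y| ^+ 2) * (1 - `|y| ^+ 2) ^+ 2) by ring.
by rewrite mulr_ge0// mulr_ge0 ?sqr_ge0// addr_ge0 ?sqr_ge0.
Qed.

Lemma continuous_osc a (eta : R -> R) z : integrableR a -> measurable_fun setT eta ->
  continuous (fun x => \int[mu]_y (a y * cos (eta y * x + z))).
Proof.
move=> ia meta x.
have int_f x' : integrableR (fun y => a y * cos (eta y * x' + z)).
  apply: (@integrableR_bounded _ _ _ 1) => //.
  - apply: measurableT_comp; first exact: continuous_measurable_fun (@continuous_cos R).
    by apply: measurable_funD => //; exact: measurable_funM.
  - by move=> y; exact: cos_max.
apply: (@continuity_under_integral _ _ _ mu (fun x y => a y * cos (eta y * x + z))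
  _ _ (x - 1) (x + 1) _ _ (fun y => `|a y|)) => //.
- by move=> x' _; exact: int_f.
- apply: aeW => y _ x' _; apply: cvgM; first exact: cvg_cst.
  have := @continuous_cos_affine R (eta y) z x'.
  by under [X in continuous_at _ X -> _]eq_fun do rewrite mulrC.
- exact: integrableR_norm.
- by move=> x' _; apply: aeW => y _; rewrite normrM ler_piMr// cos_max.
- by rewrite inE/= in_itv/= ltrBlDr !ltrDl !ltr01.
Qed.

Lemma Rintegral_gt0 f d e : integrableR f -> 0 < d -> 0 < e ->
  (forall x, 0 <= f x) -> (forall x, `|x| <= d -> e <= f x) ->
  0 < \int[mu]_x f x.
Proof.
move=> fi d0 e0 f0 fe.
have i1 : integrableR (\1_`[- d, d] : R -> R) by exact: integrable_indic_itv.
apply: (@lt_le_trans _ _ (\int[mu]_x (e * \1_`[- d, d] x))); last first.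
  apply: le_RintegralT => //; first exact: integrableRZl.
  move=> x; rewrite indicE; case: (boolP (x \in _)) => [|_].
    by rewrite inE/= in_itv/= mulr1 -ler_norml; exact: fe.
  by rewrite mulr0.
rewrite RintegralZl// mulr_gt0// /Rintegral integral_indic//= setIT.
rewrite lebesgue_measure_itv/= lte_fin gtrN// -EFinB /= opprK addr_gt0//.
Qed.

Lemma cosBpihalf x : cos (x - pi / 2) = sin x.
Proof. by rewrite cosB cos_pihalf sin_pihalf mulr0 add0r mulr1. Qed.

(** One factor [jweight] turns [|w|] into [|w| + |y^2 w|], and [y^2 w] is again rapid; the induction
    therefore generalizes over [w]. *)
Lemma integrableR_jweightX n w : rapid w ->
  integrableR (fun y => jweight y ^+ n * `|w y|).
Proof.
elim: n w => [|n IH] w rw.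
  apply: integrableR_ext (integrableR_norm (rapid_integrableR rw)) => y.
  by rewrite mul1r.
apply: integrableR_ext (integrableRD (IH _ rw) (IH _ (rapidX (rapidX rw)))) => y.
rewrite mulrA normrM (ger0_norm (_ : 0 <= y * y)) -?expr2 ?sqr_ge0//.
by rewrite [_ ^+ n.+1]exprS [X in X * _ ^+ n * _]/jweight; ring.
Qed.

(** * Division by the Fourier transform of the kernel *)

Section deconvolution.
Variables (w : R -> R) (rw : rapid w).
Let mw : measurable_fun setT w := proj1 rw.

(** Cosine and sine transforms, both in the shape [cos (x * y + z)] so that one smoothness lemma
    serves for the two. *)
Let Cw x := \int[mu]_y (w y * cos (x * y + 0)).
Let Sw x := \int[mu]_y (w y * cos (x * y - pi / 2)).

Hypothesis CSw_neq0 : forall x, Cw x ^+ 2 + Sw x ^+ 2 != 0.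

Let Cn_Cw n : Cn n Cw.
Proof. exact: Cn_cos_transform. Qed.

Let Cn_Sw n : Cn n Sw.
Proof. exact: Cn_cos_transform. Qed.

Variables (r s : R).
Hypothesis r_ge1 : 1 <= r.

(** As the bump lives on [-1, 1], only the frequencies in [s - r, s + r] occur; on this compact
    window the continuous, nowhere zero transform of [w] can be inverted with bounds. *)
Let eta x := r * x + s.
Let N x := Cw (eta x) * Cw (eta x) + Sw (eta x) * Sw (eta x).

Let N_neq0 x : N x != 0.
Proof. by rewrite /N -!expr2. Qed.

Let Cn_N n : Cn n N.
Proof. by apply: CnD; apply: CnM; exact: Cn_comp_affine. Qed.

(* [P - i Q] is the reciprocal of the Fourier transform [Cw - i Sw] of [w]. *)
Let P x := Cw (eta x) * (N x)^-1.
Let Q x := - (Sw (eta x) * (N x)^-1).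

Let Cn_P n : Cn n P.
Proof. by apply: CnM; [exact: Cn_comp_affine|exact: CnV]. Qed.

Let Cn_Q n : Cn n Q.
Proof. by apply: CnN; apply: CnM; [exact: Cn_comp_affine|exact: CnV]. Qed.

Definition bump_wave x := \int[mu]_xi (bump xi * cos (eta xi * x)).

Let iP : integrableR (fun xi => bump xi * P xi).
Proof. exact/integrableR_bump/(@Cn_continuous _ 0). Qed.

Let iQ : integrableR (fun xi => bump xi * Q xi).
Proof. exact/integrableR_bump/(@Cn_continuous _ 0). Qed.

Let m_eta : measurable_fun setT eta.
Proof. by apply: measurable_funD => //; exact: measurable_funM. Qed.

(** [G] is the real part of the integral of bump(xi) e^(i eta(xi) x) / W(eta(xi)), with W = Cw - i
    Sw: the kernel whose convolution with [w] should be [bump_wave]. *)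
Let GP x := \int[mu]_xi (bump xi * P xi * cos (eta xi * x + 0)).
Let GQ x := \int[mu]_xi (bump xi * Q xi * cos (eta xi * x - pi / 2)).
Let G x := GP x + GQ x.

Let continuous_G : continuous G.
Proof. by apply: (@CnD _ 0); exact: continuous_osc. Qed.

(** The argument of the cosine is [xi * (r * x)] plus a phase depending on [x], whence the need for
    uniformity in the phase. Since [1 <= r], decay in [r * x] implies decay in [x] with the same
    constant. *)
Let bound_part f z : (forall n, Cn n f) -> exists C, forall x,
  `|\int[mu]_xi (bump xi * f xi * cos (eta xi * x + z))| <= C * (jweight x)^-1 ^+ 3.
Proof.
move=> fn; have [C HC] := bump_cos_jweight fn.
have C0 : 0 <= C.
  have := le_trans (normr_ge0 _) (HC 0 0).
  by rewrite pmulr_lge0// exprn_gt0// invr_gt0 jweight_gt0.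
exists C => x.
rewrite (@RintegralT_eq _ _
  (fun xi => bump xi * f xi * cos (xi * (r * x) + (s * x + z)))); last first.
  by move=> xi; congr (_ * cos _); rewrite /eta; ring.
apply: (le_trans (HC (r * x) (s * x + z))).
rewrite ler_wpM2l// lerXn2r ?nnegrE ?invr_ge0 ?(ltW (jweight_gt0 _))//.
rewrite lef_pV2 ?posrE ?jweight_gt0// /jweight lerD2l.
have -> : r * x * (r * x) = (r * r) * (x * x) by ring.
rewrite ler_peMl// -?expr2 ?sqr_ge0//.
by rewrite expr_ge1// (le_trans _ r_ge1).
Qed.

Let bound_G : exists C, forall x, `|G x| <= C * (jweight x)^-1 ^+ 3.
Proof.
have [C1 H1] := bound_part 0 Cn_P; have [C2 H2] := bound_part (- (pi / 2)) Cn_Q.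
exists (C1 + C2) => x; apply: (le_trans (ler_normD _ _)).
by rewrite mulrDl; apply: lerD; [exact: H1|exact: H2].
Qed.

Let measurable_wave z (v : R) : measurable_fun setT
  (fun t : R * R => cos (eta t.2 * (v - t.1) + z)).
Proof.
apply: measurableT_comp; first exact: continuous_measurable_fun (@continuous_cos R).
apply: measurable_funD => //; apply: measurable_funM.
  exact: measurableT_comp m_eta measurable_snd.
by apply: measurable_funB => //; exact: measurable_fst.
Qed.

(** After Fubini, the addition formula separates [v] from [y]: convolving a wave with [w] multiplies
    it by the transform of [w] at its frequency. *)
Let conv_part a z v : integrableR a ->
  \int[mu]_y (w y * \int[mu]_xi (a xi * cos (eta xi * (v - y) + z))) =
  \int[mu]_xi (a xi * (cos (eta xi * v + z) * Cw (eta xi) +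
                      cos (eta xi * v + (z - pi / 2)) * Sw (eta xi))).
Proof.
move=> ia; have iw := rapid_integrableR rw.
have mwave x z' : measurable_fun setT (fun y => cos (eta y * x + z')).
  apply: measurableT_comp; first exact: continuous_measurable_fun (@continuous_cos R).
  by apply: measurable_funD => //; exact: measurable_funM.
transitivity (\int[mu]_y \int[mu]_xi (w y * (a xi * cos (eta xi * (v - y) + z)))).
  apply: RintegralT_eq => y; rewrite RintegralZl//.
  apply: (@integrableR_bounded _ _ _ 1) => // x; exact: cos_max.
rewrite (@fubiniR_prod _ _ (fun y => `|w y|) (fun xi => `|a xi|)); last 4 first.
- apply: measurable_funM.
    exact: measurableT_comp mw measurable_fst.
  apply: measurable_funM; last exact: measurable_wave.
  by apply: measurableT_comp measurable_snd; exact: integrableR_measurable.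
- exact: integrableR_norm.
- exact: integrableR_norm.
- by move=> y xi; rewrite !normrM ler_wpM2l// ler_piMr// cos_max.
apply: RintegralT_eq => xi.
have i1 z' := @integrableR_cos R w (eta xi) z' iw.
rewrite (@RintegralT_eq _ _ (fun y => (a xi * cos (eta xi * v + z)) * (w y * cos (eta xi * y + 0))
   + (a xi * cos (eta xi * v + (z - pi / 2))) * (w y * cos (eta xi * y - pi / 2)))); last first.
  move=> y.
  have -> : eta xi * (v - y) + z = (eta xi * v + z) - eta xi * y by ring.
  rewrite cosB addr0.
  rewrite addrA !cosBpihalf.
  by ring.
rewrite RintegralD//; [|exact/integrableRZl/i1|exact/integrableRZl/i1].
rewrite RintegralZl//; last exact: i1.
rewrite RintegralZl//; last exact: i1.
by rewrite -/(Cw (eta xi)) -/(Sw (eta xi)) mulrDr !mulrA.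
Qed.

Let conv_G v : \int[mu]_y (w y * G (v - y)) = bump_wave v.
Proof.
have iw := rapid_integrableR rw.
have mG (H : R -> R) : continuous H -> measurable_fun setT (fun y => H (v - y)).
  move=> cH; apply: measurableT_comp; first exact: continuous_measurable_fun cH.
  exact: measurable_funB.
have [C1 H1] := bound_part 0 Cn_P; have [C2 H2] := bound_part (- (pi / 2)) Cn_Q.
have C_ge0 C (H : R -> R) : (forall x, `|H x| <= C * (jweight x)^-1 ^+ 3) -> 0 <= C.
  move=> /(_ 0) /(le_trans (normr_ge0 _)).
  by rewrite pmulr_lge0// exprn_gt0// invr_gt0 jweight_gt0.
have iwH C (H : R -> R) : continuous H ->
    (forall x, `|H x| <= C * (jweight x)^-1 ^+ 3) ->
    integrableR (fun y => w y * H (v - y)).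
  move=> cH HC; apply: (@integrableR_bounded _ _ _ C) => //; first exact: mG.
  move=> y; apply: (le_trans (HC _)).
  rewrite ler_piMr ?(C_ge0 _ _ HC)// exprn_ile1//.
    by rewrite invr_ge0 ltW// jweight_gt0.
  by rewrite invf_le1 ?jweight_gt0// jweight_ge1.
have iwGP : integrableR (fun y => w y * GP (v - y)).
  by apply: (iwH C1) => //; exact: continuous_osc.
have iwGQ : integrableR (fun y => w y * GQ (v - y)).
  by apply: (iwH C2) => //; exact: continuous_osc.
under RintegralT_eq do rewrite mulrDr.
rewrite RintegralD//.
rewrite !conv_part//.
have cW z : Cn 0 (fun xi => cos (eta xi * v + z)).
  have := @continuous_cos_affine R (r * v) (s * v + z).
  suff -> : (fun x => cos (x * (r * v) + (s * v + z))) =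
    (fun xi => cos (eta xi * v + z)) by [].
  by apply/funext => xi; congr (cos _); rewrite /eta; ring.
have cCw : Cn 0 (fun xi => Cw (eta xi)) by exact: Cn_comp_affine.
have cSw : Cn 0 (fun xi => Sw (eta xi)) by exact: Cn_comp_affine.
rewrite -RintegralD//.
- apply: RintegralT_eq => xi.
  rewrite addr0 sub0r.
  have -> : cos (eta xi * v + (- (pi / 2) - pi / 2)) = - cos (eta xi * v).
    by rewrite addrA !cosBpihalf sinB cos_pihalf sin_pihalf; ring.
  (* The sine terms cancel because P Sw + Q Cw = 0, and the cosine keeps the factor P Cw - Q Sw =
     1. *)
  rewrite !cosBpihalf /Q /P /N; field; exact: N_neq0.
- apply: (@integrableR_ext _ (fun xi => bump xi * (P xi *
    (cos (eta xi * v + 0) * Cw (eta xi) + cos (eta xi * v + (0 - pi / 2)) * Sw (eta xi))))).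
    by move=> xi; rewrite mulrA.
  apply: integrableR_bump; apply: (CnM (Cn_P 0)).
  by apply: CnD; apply: CnM.
- apply: (@integrableR_ext _ (fun xi => bump xi * (Q xi *
    (cos (eta xi * v - pi / 2) * Cw (eta xi) + cos (eta xi * v + (- (pi / 2) - pi / 2)) * Sw (eta xi))))).
    by move=> xi; rewrite mulrA.
  apply: integrableR_bump; apply: (CnM (Cn_Q 0)).
  by apply: CnD; apply: CnM.
Qed.

Variables (F : R -> R) (K : R).
Hypotheses (cF : continuous F) (FK : forall x, `|F x| <= K * jweight x)
  (wF : forall x, \int[mu]_y (w y * F (x + y)) = 0).

Lemma integrableR_bump_wave : integrableR (fun v => F v * bump_wave v).
Proof.
have [C HC] := bound_part 0 (fun n => Cn_cst n 1).
have m1 : measurable_fun setT bump_wave.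
  have := @continuous_osc bump eta 0 integrableR_bump1 m_eta.
  under [X in continuous X -> _]eq_fun do under RintegralT_eq do rewrite addr0.
  exact: continuous_measurable_fun.
have {}HC x : `|bump_wave x| <= C * (jweight x)^-1 ^+ 3.
  by have := HC x; under [X in `|X| <= _ -> _]RintegralT_eq do rewrite mulr1 addr0.
have C0 : 0 <= C.
  have := le_trans (normr_ge0 _) (HC 0).
  by rewrite pmulr_lge0// exprn_gt0// invr_gt0 jweight_gt0.
apply: (@integrableR_jweight_dom _ (K * C)).
  by apply: measurable_funM => //; exact: continuous_measurable_fun.
move=> x; rewrite normrM.
have -> : K * C * (jweight x)^-1 = (K * jweight x) * (C * (jweight x)^-1 ^+ 2).
  by field; rewrite gt_eqF// jweight_gt0.
apply: ler_pM => //; apply: (le_trans (HC x)); apply: ler_wpM2l => //.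
rewrite [leLHS]exprS ler_piMl ?exprn_ge0 ?invr_ge0 ?(ltW (jweight_gt0 _))//.
by rewrite invf_le1 ?jweight_gt0// jweight_ge1.
Qed.

(** With [bump_wave] written as the convolution of [w] and [G], Fubini and the shift v = u + y leave
    [G u] times the integral of [w y * F (u + y)], which vanishes. The rest is domination for the
    two exchanges. *)
Lemma bump_wave_orthogonal : \int[mu]_v (F v * bump_wave v) = 0.
Proof.
have [C HC] := bound_G.
have C0 : 0 <= C.
  have := le_trans (normr_ge0 _) (HC 0).
  by rewrite pmulr_lge0// exprn_gt0// invr_gt0 jweight_gt0.
have K0 : 0 <= K.
  by have := le_trans (normr_ge0 _) (FK 0); rewrite pmulr_lge0// jweight_gt0.
have iw := rapid_integrableR rw.
have mF : measurable_fun setT F by exact: continuous_measurable_fun.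
have mG : measurable_fun setT G by exact: continuous_measurable_fun.
have mD : measurable_fun setT (fun t : R * R => t.1 - t.2).
  by apply: measurable_funB; [exact: measurable_fst|exact: measurable_snd].
have mA : measurable_fun setT (fun t : R * R => t.1 + t.2).
  by apply: measurable_funD; [exact: measurable_fst|exact: measurable_snd].
have jV n x : 0 <= (jweight x)^-1 ^+ n.
  by rewrite exprn_ge0// invr_ge0 ltW// jweight_gt0.
have jV1 x : (jweight x)^-1 <= 1 by rewrite invf_le1 ?jweight_gt0// jweight_ge1.
have a1 : integrableR (fun v => (jweight v)^-1 ^+ 2).
  apply: (@integrableR_jweight_dom _ 1).
    by apply: measurable_funX; exact: measurable_jweightV.
  by move=> x; rewrite ger0_norm// mul1r expr2 ler_piMl// invr_ge0 ltW// jweight_gt0.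
have FwG v y : `|F v * (w y * G (v - y))| <=
    K * C * 8 * (jweight v)^-1 ^+ 2 * (jweight y ^+ 3 * `|w y|).
  rewrite !normrM.
  (* Peetre's inequality for v = (v - y) + y, cubed, hence 8 = 2^3. It moves the decay from v - y to
     v at the price of weights in [y] that the moments of [w] absorb. *)
  have H : (jweight (v - y))^-1 ^+ 3 <= 8 * (jweight v)^-1 ^+ 3 * jweight y ^+ 3.
    have -> : 8 * (jweight v)^-1 ^+ 3 * jweight y ^+ 3 =
        (2 * (jweight v)^-1 * jweight y) ^+ 3 by ring.
    rewrite lerXn2r ?nnegrE ?invr_ge0 ?mulr_ge0 ?invr_ge0 ?(ltW (jweight_gt0 _))//.
    rewrite -[leLHS]mul1r ler_pdivrMr ?jweight_gt0//.
    rewrite -(ler_pM2l (jweight_gt0 v)) mulr1.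
    have -> : jweight v * (2 * (jweight v)^-1 * jweight y * jweight (v - y)) =
        2 * jweight (v - y) * jweight y.
      by field; rewrite gt_eqF// jweight_gt0.
    by have := jweightD (v - y) y; rewrite subrK.
  have -> : K * C * 8 * (jweight v)^-1 ^+ 2 * (jweight y ^+ 3 * `|w y|) =
      (K * jweight v) * (`|w y| * (C * (8 * (jweight v)^-1 ^+ 3 * jweight y ^+ 3))).
    by field; rewrite gt_eqF// jweight_gt0.
  apply: ler_pM => //; apply: ler_wpM2l => //.
  by apply: (le_trans (HC _)); exact: ler_wpM2l.
rewrite (@RintegralT_eq _ _ (fun v => \int[mu]_y (F v * (w y * G (v - y))))); last first.
  move=> v; rewrite RintegralZl ?conv_G//.
  apply: (@integrableR_bounded _ _ _ C) => //.
    by apply: measurableT_comp mG _; exact: measurable_funB.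
  move=> y; apply: (le_trans (HC _)); rewrite ler_piMr// exprn_ile1//.
    by rewrite invr_ge0 ltW// jweight_gt0.
rewrite (@fubiniR_prod _ _ (fun v => K * C * 8 * (jweight v)^-1 ^+ 2)
    (fun y => jweight y ^+ 3 * `|w y|)); last 4 first.
- apply: measurable_funM; first exact: measurableT_comp mF measurable_fst.
  apply: measurable_funM; first exact: measurableT_comp mw measurable_snd.
  exact: measurableT_comp mG mD.
- exact: integrableRZl.
- exact: integrableR_jweightX.
- exact: FwG.
have iFG y : integrableR (fun v => F v * (w y * G (v - y))).
  have ka1 := integrableRZl (K * C * 8 * (jweight y ^+ 3 * `|w y|)) a1.
  apply: (integrableR_dom ka1).
    apply: measurable_funM => //; apply: measurable_funM => //.
    by apply: measurableT_comp mG _; exact: measurable_funB.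
  by move=> v; apply: (le_trans (FwG v y)); rewrite mulrAC.
rewrite (@RintegralT_eq _ _ (fun y => \int[mu]_u (w y * F (u + y) * G u))); last first.
  move=> y; rewrite -(Rintegral_shift y (iFG y)).
  by apply: RintegralT_eq => u; rewrite addrK; ring.
(* Here Peetre's inequality is applied to the growth of F(u + y), and the decay of [G u] is
   available directly, so one weight in [y] suffices. *)
rewrite (@fubiniR_prod _ _ (fun y => jweight y ^+ 1 * `|w y|)
  (fun u => K * C * 2 * (jweight u)^-1 ^+ 2)); last 4 first.
- rewrite (_ : (fun _ => _) = (fun t : R * R => w t.1 * F (t.1 + t.2) * G t.2)); last first.
    by apply/funext => t; rewrite addrC.
  apply: measurable_funM; last exact: measurableT_comp mG measurable_snd.
  apply: measurable_funM; first exact: measurableT_comp mw measurable_fst.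
  exact: measurableT_comp mF mA.
- exact: integrableR_jweightX.
- exact: integrableRZl.
- move=> y u; rewrite !normrM expr1.
  have -> : jweight y * `|w y| * (K * C * 2 * (jweight u)^-1 ^+ 2) =
     `|w y| * (K * (2 * jweight u * jweight y)) * (C * (jweight u)^-1 ^+ 3).
    by field; rewrite gt_eqF// jweight_gt0.
  apply: ler_pM => //.
  apply: ler_wpM2l => //; apply: (le_trans (FK _)).
  by apply: ler_wpM2l => //; exact: jweightD.
rewrite (@RintegralT_eq _ _ (fun=> 0)) ?Rintegral_cst ?mul0r// => u.
rewrite RintegralZr ?wF ?mul0r//.
apply: (@integrableR_dom _ (fun y => (K * 2 * jweight u) * (jweight y ^+ 1 * `|w y|))).
- exact/integrableRZl/integrableR_jweightX.
- apply: measurable_funM => //; apply: measurableT_comp mF _.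
  exact: measurable_funD.
- move=> y; rewrite normrM.
  have -> : K * 2 * jweight u * (jweight y ^+ 1 * `|w y|) =
    `|w y| * (K * (2 * jweight u * jweight y)) by ring.
  apply: ler_wpM2l => //; apply: (le_trans (FK _)).
  by apply: ler_wpM2l => //; exact: jweightD.
Qed.

End deconvolution.

(** * A fixed test function and its dilations *)

Definition cos_bump x := \int[mu]_xi (bump xi * cos (xi * x)).

Lemma bump_ge0 x : 0 <= bump x.
Proof. by rewrite /bump mulr_ge0// ?indicE ?ler0n// (exprM _ 2 3) exprn_ge0// sqr_ge0. Qed.

Lemma continuous_cos_bump : continuous cos_bump.
Proof.
have := @continuous_osc bump id 0 integrableR_bump1 (@measurable_id _ _ _).
by rewrite /cos_bump; under [X in continuous X -> _]eq_fun do
  under RintegralT_eq do rewrite addr0.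
Qed.

Lemma cos_bump_bound : exists C, forall x, `|cos_bump x| <= C * (jweight x)^-1 ^+ 3.
Proof.
have [C HC] := @bump_cos_jweight (fun=> 1) (fun n => Cn_cst n 1).
exists C => x; have := HC x 0.
by under [X in `|X| <= _ -> _]RintegralT_eq do rewrite mulr1 addr0.
Qed.

Lemma integrableR_cos_bump : integrableR cos_bump.
Proof.
have [C HC] := cos_bump_bound.
have C0 : 0 <= C.
  have := le_trans (normr_ge0 _) (HC 0).
  by rewrite pmulr_lge0// exprn_gt0// invr_gt0 jweight_gt0.
apply: (@integrableR_jweight_dom _ C).
  by apply: continuous_measurable_fun; exact: continuous_cos_bump.
move=> x; apply: (le_trans (HC x)); apply: ler_wpM2l => //.
rewrite exprS ler_piMr ?invr_ge0 ?(ltW (jweight_gt0 _))// exprn_ile1//.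
  by rewrite invr_ge0 ltW// jweight_gt0.
by rewrite invf_le1 ?jweight_gt0// jweight_ge1.
Qed.

Lemma cos_bump0_gt0 : 0 < cos_bump 0.
Proof.
rewrite /cos_bump; under RintegralT_eq do rewrite mulr0 cos0 mulr1.
(* On |x| <= 1/2 the base 1 - x^2 is at least 3/4. *)
apply: (@Rintegral_gt0 _ (1 / 2) ((3 / 4) ^+ 6)) => //.
- exact: integrableR_bump1.
- exact: bump_ge0.
move=> x xh; rewrite /bump indicE mem_set ?mulr1; last first.
  by rewrite /= in_itv/= -ler_norml; apply: (le_trans xh); lra.
rewrite lerXn2r ?nnegrE//; last first.
  have : x * x = `|x| * `|x| by rewrite -normrM ger0_norm// -expr2 sqr_ge0.
  have := normr_ge0 x; nra.
have : x * x = `|x| * `|x| by rewrite -normrM ger0_norm// -expr2 sqr_ge0.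
have := normr_ge0 x; nra.
Qed.

(* Otherwise [\int cos_bump^2 = 0], by Fubini. *)
Lemma cos_bump_modulation : exists s,
  \int[mu]_x (cos_bump x * cos (s * x)) != 0.
Proof.
apply: contrapT => /forallNP H.
have {}H s : \int[mu]_x (cos_bump x * cos (s * x)) = 0.
  by apply/eqP/negP => /negP; exact: H.
have icb := integrableR_cos_bump.
have mcb : measurable_fun setT cos_bump by exact: integrableR_measurable.
have [C HC] := cos_bump_bound.
have C0 : 0 <= C.
  have := le_trans (normr_ge0 _) (HC 0).
  by rewrite pmulr_lge0// exprn_gt0// invr_gt0 jweight_gt0.
have i2 : integrableR (fun x => cos_bump x * cos_bump x).
  apply: (@integrableR_bounded _ _ _ C) => // x; apply: (le_trans (HC x)).
  rewrite ler_piMr// exprn_ile1//; first by rewrite invr_ge0 ltW// jweight_gt0.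
  by rewrite invf_le1 ?jweight_gt0// jweight_ge1.
have : 0 < \int[mu]_x (cos_bump x * cos_bump x).
  have c0 := cos_bump0_gt0.
  have [d /= d0 Hd] : exists2 d : R, 0 < d &
      forall x, `|x| <= d -> cos_bump 0 / 2 <= cos_bump x.
    have h0 : 0 < cos_bump 0 / 2 by rewrite divr_gt0.
    have /cvgrPdist_le /(_ _ h0) /nbhs_ballP[e /= e0 He] := @continuous_cos_bump 0.
    exists (e / 2); first by rewrite divr_gt0.
    move=> x xe; have := He x; rewrite /ball/= sub0r normrN.
    move=> /(_ (le_lt_trans xe _)); rewrite gtr_pMr// invf_lt1// ltr1n.
    by move=> /(_ isT); rewrite ler_distl => /andP[]; lra.
  apply: (@Rintegral_gt0 _ d ((cos_bump 0 / 2) * (cos_bump 0 / 2))) => //.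
  - by rewrite mulr_gt0// divr_gt0.
  - by move=> x; rewrite -expr2 sqr_ge0.
  - by move=> x /Hd h; apply: ler_pM => //; rewrite ltW// divr_gt0.
rewrite (@RintegralT_eq _ _ (fun x => \int[mu]_xi (cos_bump x * (bump xi * cos (xi * x))))); last first.
  move=> x; rewrite RintegralZl//.
  apply: integrableR_bump => xi.
  have := @continuous_cos_affine R x 0 xi.
  by under [X in continuous_at _ X -> _]eq_fun do rewrite addr0.
rewrite (@fubiniR_prod _ _ (fun x => `|cos_bump x|) (fun xi => `|bump xi|)); last 4 first.
- apply: measurable_funM; first exact: measurableT_comp mcb measurable_fst.
  apply: measurable_funM.
    apply: measurableT_comp measurable_snd.
    exact: (integrableR_measurable integrableR_bump1).
  apply: measurableT_comp; first exact: continuous_measurable_fun (@continuous_cos R).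
  by apply: measurable_funM; [exact: measurable_snd|exact: measurable_fst].
- exact: integrableR_norm.
- exact/integrableR_norm/integrableR_bump1.
- by move=> x xi; rewrite !normrM ler_wpM2l// ler_piMr// cos_max.
rewrite (@RintegralT_eq _ _ (fun=> 0)) ?Rintegral_cst ?mul0r ?ltxx// => xi.
rewrite (@RintegralT_eq _ _ (fun x => bump xi * (cos_bump x * cos (xi * x)))).
  rewrite RintegralZl ?H ?mulr0//.
  apply: integrableR_ext (@integrableR_cos R cos_bump xi 0 icb) => x.
  by rewrite addr0.
by move=> x; rewrite mulrCA.
Qed.

(** For every n the integral of F(x / (n+1)) Psi(x) is zero, since a dilate of Psi is a mean of two
    functions [bump_wave]. Dominated convergence turns this into F(0) times the nonzero integral of
    Psi. The value at 0 is enough, as the hypotheses are stable under translation. *)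
Lemma convolution_injective0 w (F : R -> R) (K : R) : rapid w ->
  (forall x, (\int[mu]_y (w y * cos (x * y + 0))) ^+ 2 +
             (\int[mu]_y (w y * cos (x * y - pi / 2))) ^+ 2 != 0) ->
  continuous F -> (forall x, `|F x| <= K * jweight x) ->
  (forall x, \int[mu]_y (w y * F (x + y)) = 0) -> F 0 = 0.
Proof.
move=> rw w0 cF FK wF; have [s Hs] := cos_bump_modulation.
have K0 : 0 <= K.
  by have := le_trans (normr_ge0 _) (FK 0); rewrite pmulr_lge0// jweight_gt0.
have [C HC] := cos_bump_bound.
have C0 : 0 <= C.
  have := le_trans (normr_ge0 _) (HC 0).
  by rewrite pmulr_lge0// exprn_gt0// invr_gt0 jweight_gt0.
pose Psi x := cos_bump x * cos (s * x).
have mcb : measurable_fun setT cos_bump.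
  by apply: continuous_measurable_fun; exact: continuous_cos_bump.
have mPsi : measurable_fun setT Psi.
  apply: measurable_funM => //.
  by under eq_fun do rewrite -[s * _]addr0; exact: measurable_cos_affine2.
have mF : measurable_fun setT F by exact: continuous_measurable_fun.
have PsiC x : `|Psi x| <= C * (jweight x)^-1 ^+ 3.
  by rewrite normrM; apply: le_trans (HC x); rewrite ler_piMr// cos_max.
(* The dilation factor starts at 1, as required by the bounds on [bump_wave]; it also makes the
   growth bound on [F] uniform in [n]. *)
pose f_ n x := F (n.+1%:R^-1 * x) * Psi x.
have f_dom n x : `|f_ n x| <= K * C * (jweight x)^-1.
  rewrite normrM.
  have -> : K * C * (jweight x)^-1 = (K * jweight x) * (C * (jweight x)^-1 ^+ 2).
    by field; rewrite gt_eqF// jweight_gt0.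
  apply: ler_pM => //.
    apply: (le_trans (FK _)); apply: ler_wpM2l => //; rewrite /jweight lerD2l.
    have -> : n.+1%:R^-1 * x * (n.+1%:R^-1 * x) = (n.+1%:R^-1) ^+ 2 * (x * x) by ring.
    rewrite ler_piMl -?expr2 ?sqr_ge0// exprn_ile1 ?invr_ge0//.
    by rewrite invf_le1 ?ltr0n// ler1n.
  apply: (le_trans (PsiC x)); apply: ler_wpM2l => //.
  rewrite [leLHS]exprS ler_piMl ?exprn_ge0 ?invr_ge0 ?(ltW (jweight_gt0 _))//.
  by rewrite invf_le1 ?jweight_gt0// jweight_ge1.
have mf_ n : measurable_fun setT (f_ n).
  apply: measurable_funM => //; apply: measurableT_comp mF _.
  exact: measurable_funM.
have if_ n : integrableR (f_ n).
  exact: (@integrableR_jweight_dom _ (K * C)).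
have f_0 n : \int[mu]_x f_ n x = 0.
  have n0 : 0 < n.+1%:R :> R by rewrite ltr0n.
  rewrite (Rintegral_affine 0 n0 (if_ n)).
  have n1 : 1 <= n.+1%:R :> R by rewrite ler1n.
  have iw' s' : integrableR (fun v => F v * bump_wave n.+1%:R s' v).
    exact: (integrableR_bump_wave _ n1 cF FK).
  have iwave s' v : integrableR (fun xi => bump xi * cos ((n.+1%:R * xi + s') * v)).
    apply: integrableR_bump.
    have := @continuous_cos_affine R (n.+1%:R * v) (s' * v).
    suff -> : (fun x => cos (x * (n.+1%:R * v) + s' * v)) =
       (fun xi => cos ((n.+1%:R * xi + s') * v)) by [].
    by apply/funext => xi; congr (cos _); ring.
  (* Product-to-sum formula: modulation by cos(s x) splits into the frequency shifts [n.+1 * s] and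
     [- (n.+1 * s)]. *)
  rewrite (@RintegralT_eq _ _ (fun v => 2^-1 * (F v * bump_wave n.+1%:R (n.+1%:R * s) v)
       + 2^-1 * (F v * bump_wave n.+1%:R (- (n.+1%:R * s)) v))).
    rewrite RintegralD//; [|exact/integrableRZl/iw'|exact/integrableRZl/iw'].
    rewrite RintegralZl//; last exact: iw'.
    rewrite RintegralZl//; last exact: iw'.
    by rewrite !(bump_wave_orthogonal rw w0 _ n1 cF FK wF) mulr0 addr0 mulr0.
  move=> v; rewrite /f_ addr0 mulKf ?gt_eqF//.
  rewrite -!mulrDr [RHS]mulrCA; congr (_ * _).
  rewrite /Psi /bump_wave -RintegralD//; [|exact: iwave|exact: iwave].
  rewrite (@RintegralT_eq _ _ (fun xi => 2 * cos (s * (n.+1%:R * v)) *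
      (bump xi * cos ((n.+1%:R * xi + 0) * v)))); last first.
    move=> xi.
    have -> : (n.+1%:R * xi + n.+1%:R * s) * v =
      n.+1%:R * xi * v + s * (n.+1%:R * v) by ring.
    have -> : (n.+1%:R * xi - n.+1%:R * s) * v =
      n.+1%:R * xi * v - s * (n.+1%:R * v) by ring.
    by rewrite addr0 cosD cosB; ring.
  rewrite RintegralZl//; last exact: iwave.
  rewrite -mulrA mulKf// mulrC; congr (_ * _).
  by apply: RintegralT_eq => xi; congr (_ * cos _); ring.
have cv := @cvg_RintegralT _ f_ (fun x => F 0 * Psi x)
   (fun x => K * C * (jweight x)^-1) mf_ _ (integrableRZl _ integrableR_jweightV) f_dom _.
have /cvg_lim : (\int[mu]_x f_ n x) @[n --> \oo] --> \int[mu]_x (F 0 * Psi x).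
  apply: cv; first exact: measurable_funM.
  move=> x; apply: cvgM; last exact: cvg_cst.
  have : (n.+1%:R^-1 * x) @[n --> \oo] --> 0 * x.
    by apply: cvgM; [exact: cvg_harmonic|exact: cvg_cst].
  rewrite mul0r => h; apply: (cvg_comp _ _ h); exact: cF.
move=> /(_ (@Rhausdorff _)).
under eq_fun do rewrite f_0.
rewrite lim_cst; last exact: Rhausdorff.
rewrite RintegralZl.
  by move/esym/eqP; rewrite mulf_eq0 (negbTE Hs) orbF => /eqP.
- exact: measurableT.
- apply: integrableR_ext (@integrableR_cos R cos_bump s 0 integrableR_cos_bump) => x.
  by rewrite addr0.
Qed.

End tauberian.

(** * Injectivity of the convolution *)

Section local_averages.
Context {R : realType}.
Local Notation mu := (@lebesgue_measure R).
Implicit Types (t u v x y : R).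

Lemma locally_integrable_itv (h : R -> R) (a b : R) :
  locally_integrable setT h -> mu.-integrable `[a, b] (EFin \o h).
Proof.
move=> [mh _ lh]; apply/integrableP; split.
  by apply/measurable_EFinP; exact: measurable_funTS.
by apply: lh => //; exact: segment_compact.
Qed.

Variables (h w : R -> R) (C : R).
Hypotheses (lh : locally_integrable setT h) (rw : rapid w).
Hypotheses (w_ge0 : forall y, 0 <= w y).
Hypothesis iwh : forall x, integrableR (fun y => w y * h (x + y)).
Hypothesis wh_bound : forall x, \int[mu]_y (w y * `|h (x + y)|) <= C * jweight x.
Hypothesis wh0 : forall x, \int[mu]_y (w y * h (x + y)) = 0.
Hypothesis w_fourier : forall x, (\int[mu]_y (w y * cos (x * y + 0))) ^+ 2 +
             (\int[mu]_y (w y * cos (x * y - pi / 2))) ^+ 2 != 0.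

Let mh : measurable_fun setT h. Proof. by case: lh. Qed.

Let mhD x : measurable_fun setT (fun y : R => h (x + y)).
Proof. by apply: measurableT_comp mh _; exact: measurable_funD. Qed.

Variables (y0 d e : R).
Hypotheses (d0 : 0 < d) (e0 : 0 < e).
Hypothesis w_ge : forall y, `|y - y0| <= d -> e <= w y.

Let J v := \int[mu]_u (\1_`]0, d] u * h (v + u)).

Let m1 : measurable_fun setT (\1_`]0, d] : R -> R).
Proof. exact: measurable_indic. Qed.

Let indic01 (u : R) : 0 <= (\1_`]0, d] u : R) <= 1.
Proof. by rewrite indicE ler0n lern1 leq_b1. Qed.

(** On the window ]0, d] the shifted weight w(u + y0) is at least [e], so the indicator is at most
    w(u + y0) / e. This is how bounds known only for integrals against [w] reach the averages of
    [h]. *)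
Let J_dom v u : `|\1_`]0, d] u * h (v + u)| <=
  e^-1 * (w (u + y0) * `|h (v - y0 + (u + y0))|).
Proof.
rewrite (_ : v - y0 + (u + y0) = v + u); last by ring.
rewrite normrM mulrA ler_wpM2r// ger0_norm; last by case/andP: (indic01 u).
rewrite indicE; case: (boolP (u \in _)) => [|_]; last first.
  by rewrite mulr_ge0// invr_ge0 ltW.
rewrite inE/= in_itv/= => /andP[u0 ud]; rewrite mulrC ler_pdivlMr// mul1r.
by apply: w_ge; rewrite addrK ger0_norm// ltW.
Qed.

Let iJ v : integrableR (fun u => \1_`]0, d] u * h (v + u)).
Proof.
apply: (integrableR_dom _ _ (J_dom v)).
  apply: integrableRZl.
  apply: (@integrableR_shift _ y0 (fun y => w y * `|h (v - y0 + y)|)).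
  apply: integrableR_ext (integrableR_norm (iwh (v - y0))) => y.
  by rewrite normrM ger0_norm.
exact: measurable_funM.
Qed.

Let iwnh x : integrableR (fun y => w y * `|h (x + y)|).
Proof.
by apply: integrableR_ext (integrableR_norm (iwh x)) => y; rewrite normrM ger0_norm.
Qed.

Let C_ge0 : 0 <= C.
Proof.
rewrite -(pmulr_lge0 _ (jweight_gt0 0)); apply: le_trans (wh_bound 0).
by apply: Rintegral_ge0 => y _; rewrite mulr_ge0.
Qed.

Let J_bound v : `|J v| <= (e^-1 * C * 2 * jweight (- y0)) * jweight v.
Proof.
have i2 := integrableR_shift y0 (iwnh (v - y0)).
apply: (le_trans (le_normr_Rintegral _ (iJ v))) => //.
apply: (@le_trans _ _ (e^-1 * \int[mu]_u (w (u + y0) * `|h (v - y0 + (u + y0))|))).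
  rewrite -RintegralZl//; apply: le_RintegralT (J_dom v).
    exact: integrableR_norm (iJ v).
  exact: integrableRZl.
rewrite (@Rintegral_shift _ y0 (fun y => w y * `|h (v - y0 + y)|))//.
have ei : 0 <= e^-1 by rewrite invr_ge0 ltW.
rewrite -!mulrA ler_wpM2l//; apply: (le_trans (wh_bound _)).
rewrite ler_wpM2l//; apply: (le_trans (jweightD v (- y0))).
by rewrite -mulrA (mulrC (jweight v)).
Qed.

(** [J] superposes translates of [h], each annihilated by [w]. The slices are uniformly bounded
    because [u] stays in ]0, d]. *)
Let J_conv x : \int[mu]_y (w y * J (x + y)) = 0.
Proof.
have mhDD : measurable_fun setT (fun t : R * R => h (x + (t.1 + t.2))).
  apply: measurableT_comp mh _; apply: measurable_funD => //.
  by apply: measurable_funD; [exact: measurable_fst|exact: measurable_snd].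
have mw : measurable_fun setT w by case: rw.
rewrite (@RintegralT_eq _ _
  (fun y => \int[mu]_u (\1_`]0, d] u * (w y * h (x + (u + y)))))); last first.
  move=> y; rewrite -RintegralZl//; last exact: iJ.
  by apply: RintegralT_eq => u; rewrite mulrCA (addrC u) addrA.
rewrite -(@fubiniR _ (fun u y => \1_`]0, d] u * (w y * h (x + (u + y))))
    (fun u => C * 2 * jweight x * (1 + d * d) * \1_`]0, d] u)).
- rewrite (@RintegralT_eq _ _ (fun=> 0)) ?Rintegral_cst ?mul0r// => u.
  rewrite (@RintegralT_eq _ _ (fun y => \1_`]0, d] u * (w y * h (x + u + y)))).
    by rewrite RintegralZl; [rewrite wh0 mulr0|by []|exact: iwh].
  by move=> y; rewrite addrA.
- apply: measurable_funM; first exact: measurableT_comp m1 measurable_fst.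
  apply: measurable_funM => //; exact: measurableT_comp mw measurable_snd.
- move=> u; apply: integrableRZl.
  by apply: integrableR_ext (iwh (x + u)) => y; rewrite addrA.
- move=> y; apply: integrableR_ext (integrableRZl (w y) (iJ (x + y))) => u.
  by rewrite mulrCA (addrC u) addrA.
- move=> u.
  rewrite (@RintegralT_eq _ _ (fun y => \1_`]0, d] u * (w y * `|h (x + u + y)|))); last first.
    move=> y; rewrite !normrM addrA ger0_norm; last by case/andP: (indic01 u).
    by rewrite (ger0_norm (w_ge0 y)).
  rewrite RintegralZl//; last exact: iwnh.
  rewrite mulrC indicE; case: (boolP (u \in _)) => [|_]; last by rewrite !mulr0.
  rewrite inE/= in_itv/= => /andP[u0 ud]; rewrite !mulr1.
  apply: (le_trans (wh_bound _)); rewrite -!mulrA ler_wpM2l//.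
  apply: (le_trans (jweightD _ _)); rewrite -mulrA ler_wpM2l// ler_wpM2l//.
    exact: ltW (jweight_gt0 _).
  by rewrite /jweight lerD2l ler_pM// ltW.
- by apply: integrableRZl; exact: integrable_indic_itv.
Qed.

Let J_itv v : J v = \int[mu]_(t in `]v, v + d]) h t.
Proof.
rewrite /J (@RintegralT_eq _ _ (fun u => (\1_`]v, v + d] (u + v) * h (u + v)))).
  rewrite (@Rintegral_shift _ v (fun t => \1_`]v, v + d] t * h t)).
    rewrite [RHS]Rintegral_mkcond; apply: RintegralT_eq => t.
    by rewrite patchE indicE; case: ifP => _; rewrite ?mul1r ?mul0r.
  apply: integrableR_ext (integrableR_shift (- v) (iJ v)) => t.
  rewrite /= (_ : v + (t - v) = t); last by ring.
  congr (_ * _).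
  rewrite !indicE; congr (_%:R); congr nat_of_bool; apply/idP/idP; rewrite !inE/= !in_itv/= => /andP[? ?];
   apply/andP; split; lra.
move=> u; rewrite (addrC v); congr (_ * _).
rewrite !indicE; congr (_%:R); congr nat_of_bool; apply/idP/idP; rewrite !inE/= !in_itv/= => /andP[? ?];
   apply/andP; split; lra.
Qed.

(** [J] is the increment over length [d] of a primitive of [h]. The base interval exceeds [v, v + d]
    by 1 on both sides, so nearby points can share the same primitive. *)
Let J_continuous : continuous J.
Proof.
move=> v0; pose v : R := v0; rewrite -/v; pose a : R := v - 1; pose b : R := v + d + 1.
have ab : a < b by rewrite /a /b -addrA ltrD2l; move: d0; lra.
pose H x := \int[mu]_(t in `[a, x]) h t.
have cH : {in `]a, b[, continuous H}.
  have := parameterized_integral_continuous (ltW ab) (locally_integrable_itv a b lh).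
  by move=> /(continuous_within_itvP _ ab)[].
have JE : {near v, (fun x => H (x + d) - H x) =1 J}.
  near=> x.
  have xv : `|v - x| < 1 by near: x; exact: cvgr_dist_lt.
  have [x1 x2] : a <= x /\ x + d <= b.
    by move: xv; rewrite ltr_distl /a /b => /andP[]; lra.
  rewrite J_itv /H Rintegral_itvB//.
  - exact: locally_integrable_itv.
  - by rewrite bnd_simp lerDl ltW.
apply: cvg_trans; first exact: (near_eq_cvg JE).
rewrite -(nbhs_singleton JE).
apply: cvgB.
- apply: (@continuous_comp _ _ _ (fun x => x + d) H).
    by apply: cvgD; [exact: cvg_id|exact: cvg_cst].
  by apply: cH; rewrite in_itv/=; apply/andP; split; rewrite /a /b; move: d0; lra.
- by apply: cH; rewrite in_itv/=; apply/andP; split; rewrite /a /b; move: d0; lra.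
Unshelve. all: by end_near. Qed.

(** The previous result concerns the value at 0, hence its application to the translate of [J] by
    [v]; Peetre's inequality supplies the growth bound of this translate. *)
Lemma local_average_eq0 v : \int[mu]_(t in `]v, v + d]) h t = 0.
Proof.
rewrite -J_itv; pose F x := J (v + x).
suff : F 0 = 0 by rewrite /F addr0.
apply: (@convolution_injective0 _ w F ((e^-1 * C * 2 * jweight (- y0)) * (2 * jweight v))) => //.
- move=> x; apply: (@continuous_comp _ _ _ (fun x => v + x) J); last exact: J_continuous.
  by apply: cvgD; [exact: cvg_cst|exact: cvg_id].
- move=> x; apply: (le_trans (J_bound (v + x))).
  rewrite -[leRHS]mulrA; apply: ler_wpM2l; last exact: jweightD.
  by rewrite !mulr_ge0 ?invr_ge0 ?(ltW e0) ?(ltW (jweight_gt0 _)).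
- move=> x; rewrite -(J_conv (v + x)); apply: RintegralT_eq => y.
  by rewrite /F addrA.
Qed.

End local_averages.

(** * From vanishing averages to vanishing almost everywhere *)

Section convolution_injective.
Context {R : realType}.
Local Notation mu := (@lebesgue_measure R).

(** At a Lebesgue point the primitive of [h] has derivative [h x]; but its increments over short
    intervals vanish, so it is constant near [x]. *)
Lemma local_averages_ae0 (h : R -> R) (d : R) : 0 < d -> locally_integrable setT h ->
  (forall p q : R, p < q -> q <= p + d -> \int[mu]_(t in `]p, q]) h t = 0) ->
  {ae mu, forall x, h x = 0}.
Proof.
move=> d0 lh h0; apply: aeS (lebesgue_differentiation lh) => x hx.
have ih : mu.-integrable `[x - 1, x + 1] (EFin \o h) by exact: locally_integrable_itv.
have x1 : x < x + 1 by rewrite ltrDl.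
have := @FTC1_lebesgue_pt R h (BLeft (x - 1)) x (x + 1) x1 ih.
move=> /= /(_ _ hx)[|dF <-]; first by rewrite (@lte_fin R); lra.
rewrite derive1E.
set F := (F in 'D_1 F x).
rewrite (@near_eq_derive _ _ _ F (cst (F x))) ?derive_cst//.
near=> y.
have yd : `|x - y| < d by near: y; exact: cvgr_dist_lt.
have y1 : `|x - y| < 1 by near: y; exact: cvgr_dist_lt.
move: yd y1; rewrite !ltr_distl => /andP[yd1 yd2] /andP[y1 y2].
have [xy|yx|->//] := ltgtP x y.
- apply/eqP; rewrite -subr_eq0 /F /= Rintegral_itvB.
  + by rewrite h0//; lra.
  + exact: locally_integrable_itv.
  + by rewrite bnd_simp; lra.
  + by rewrite bnd_simp; lra.
- apply/esym/eqP; rewrite -subr_eq0 /F /= Rintegral_itvB.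
  + by rewrite h0//; lra.
  + exact: locally_integrable_itv.
  + by rewrite bnd_simp; lra.
  + by rewrite bnd_simp; lra.
Unshelve. all: by end_near. Qed.

Theorem convolution_injective (h w : R -> R) (C y0 : R) :
  locally_integrable setT h -> rapid w -> continuous w -> (forall y, 0 <= w y) ->
  0 < w y0 ->
  (forall x, (\int[mu]_y (w y * cos (x * y + 0))) ^+ 2 +
             (\int[mu]_y (w y * cos (x * y - pi / 2))) ^+ 2 != 0) ->
  (forall x, integrableR (fun y => w y * h (x + y))) ->
  (forall x, \int[mu]_y (w y * `|h (x + y)|) <= C * jweight x) ->
  (forall x, \int[mu]_y (w y * h (x + y)) = 0) ->
  {ae mu, forall x, h x = 0}.
Proof.
move=> lh rw cw w0 wy0 w_fourier iwh whC wh0.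
have e0 : 0 < w y0 / 2 by rewrite divr_gt0.
have /cvgrPdist_le /(_ _ e0) /nbhs_ballP[e /= ee He] := cw y0.
(* Halving the radius passes from the open ball given by continuity to the closed one needed for the
   lower bound on [w]. *)
have ed : 0 < e / 2 by rewrite divr_gt0.
apply: (local_averages_ae0 ed lh) => p q pq qp.
rewrite (_ : q = p + (q - p)); last by rewrite addrC subrK.
apply: (local_average_eq0 lh rw w0 iwh whC wh0 w_fourier _ e0 (y0 := y0)).
  by rewrite subr_gt0.
move=> y yd; have := He y; rewrite /ball/= distrC.
move=> /(_ (le_lt_trans yd _)); rewrite ltrBlDl => /(_ (le_lt_trans qp _)).
rewrite ltrD2l gtr_pMr// invf_lt1// ltr1n => /(_ isT).
by rewrite ler_distl => /andP[]; lra.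
Qed.

End convolution_injective.

(** * Kullback-Leibler divergence to a prior *)

Section schwartz_real.
Context {R : realType}.
Local Notation mu := (@lebesgue_measure R).
Implicit Types (B : R -> R) (x y : R).

Lemma schwartz_toC_bound B (i : nat) : schwartz (toC B) ->
  exists M, forall x, `|x ^+ i * B x| <= M.
Proof.
move=> [_ /(_ i 0%N)[M HM]]; exists M => x; have := HM x.
rewrite /schwartz_weight /cderiven /toC normc_def lecR /= !mul0r !mulr0 addr0 subr0.
by rewrite expr0n /= addr0 sqrtr_sqr.
Qed.

Lemma schwartz_toC_continuous B : schwartz (toC B) -> continuous B.
Proof.
move=> [sB _] x; have [dB _] := sB 0%N x.
exact/differentiable_continuous/derivable1_diffP.
Qed.

(** The seminorms of orders n and n + 2 together bound [jweight x * |x^n * B x|], and [jweight^-1]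
    is integrable. *)
Lemma schwartz_toC_rapid B : schwartz (toC B) -> rapid B.
Proof.
move=> sB; have mB : measurable_fun setT B.
  by apply: continuous_measurable_fun; exact: schwartz_toC_continuous.
split=> // n; have [M1 H1] := schwartz_toC_bound n sB.
have [M2 H2] := schwartz_toC_bound n.+2 sB.
apply: (@integrableR_jweight_dom _ _ (M1 + M2)).
  by apply: measurable_funM => //; exact: measurable_funX.
move=> x; rewrite ler_pdivlMr ?jweight_gt0// /jweight mulrDr mulr1.
apply: lerD; first exact: H1.
apply: le_trans (H2 x); rewrite !exprS -!mulrA !normrM.
have -> : x * x = `|x| * `|x| by rewrite -normrM ger0_norm// -expr2 sqr_ge0.
by rewrite [leLHS](_ : _ = `|x| * (`|x| * (`|x ^+ n| * `|B x|)))//; ring.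
Qed.

Lemma fourier_toC_neq0 B x : integrableR B -> fourier (toC B) x <> 0 ->
  (\int[mu]_y (B y * cos (x * y + 0))) ^+ 2 +
  (\int[mu]_y (B y * cos (x * y - pi / 2))) ^+ 2 != 0.
Proof.
move=> iB; apply: contra_notN.
rewrite paddr_eq0 ?sqr_ge0// !sqrf_eq0 => /andP[/eqP C0 /eqP S0].
rewrite /fourier /cintegral /toC /cis /=.
apply/eqP; rewrite eq_complex /=; apply/andP; split; apply/eqP.
- rewrite -[RHS]C0; apply: RintegralT_eq => y.
  by rewrite cosN mul0r subr0 addr0.
- rewrite (@RintegralT_eq _ _ (fun y => -1 * (B y * cos (x * y - pi / 2)))).
    by rewrite RintegralZl ?S0 ?mulr0//; exact: integrableR_cos.
  by move=> y; rewrite sinN mul0r addr0 cosBpihalf mulN1r mulrN.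
Qed.

End schwartz_real.

(** * Cross entropy *)

Section cross_entropy.
Context {R : realType}.
Local Notation mu := (@lebesgue_measure R).
Implicit Types (x y m : R).

Variables (B alpha : R -> R).
Hypotheses (dB : density B) (entB : finite_entropy B).
Hypotheses (pa : prior alpha).

Let l x := ln (alpha x).

Let mB : measurable_fun setT B. Proof. by case: dB. Qed.
Let B_ge0 x : 0 <= B x. Proof. by case: dB. Qed.
Let ma : measurable_fun setT alpha. Proof. by case: pa => -[]. Qed.
Let a_ge0 x : 0 <= alpha x. Proof. by case: pa => -[]. Qed.
Let ml : measurable_fun setT l. Proof. exact: measurableT_comp. Qed.

Lemma density_Rintegral (f : R -> R) : density f ->
  integrableR f /\ \int[mu]_x f x = 1.
Proof.
move=> [mf f0 f1]; have fi : integrableR f.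
  by apply: integrableR_fin_num => //; rewrite f1.
by split=> //; rewrite /Rintegral f1.
Qed.

Lemma prior_density : density alpha.
Proof. by case: pa. Qed.

Let BmE m : measurable_fun setT (fun x => B (x - m)).
Proof. by apply: measurableT_comp mB _; exact: measurable_funB. Qed.

(** The inverse is exp(- ln alpha) where [alpha] is positive; elsewhere [alpha] is 0 and its inverse
    is 0 by convention, which the indicator reproduces. *)
Let maV : measurable_fun setT (fun x => (alpha x)^-1).
Proof.
rewrite (_ : (fun _ => _) = (fun x => expR (- l x) * \1_`]0, +oo[ (alpha x))).
  apply: measurable_funM; first by do 2 apply: measurableT_comp => //.
  exact: measurableT_comp.
apply/funext => x; rewrite indicE /l.
have [a0|a0] := ltP 0 (alpha x).
  by rewrite mem_set ?mulr1/= ?in_itv/= ?a0// expRN lnK.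
rewrite memNset/=; last by rewrite in_itv/= andbT; apply/negP; rewrite -leNgt.
have -> : alpha x = 0 by apply/eqP; rewrite eq_le a0 a_ge0.
by rewrite invr0 mulr0.
Qed.

Let ent_shift m : integrableR (fun x => ln (B (x - m)) * B (x - m)).
Proof. exact: (@integrableR_shift _ (- m) (fun x => ln (B x) * B x)). Qed.

(* On [B = 0] both sides vanish, whatever the junk value of [ln] at [0]. *)
Let KL_split m : {ae mu, forall x, ln (B (x - m) / alpha x) * B (x - m) =
  ln (B (x - m)) * B (x - m) - l x * B (x - m)}.
Proof.
have [_ a0 _] := pa; apply: aeS a0 => x ax.
have [->|Bx] := eqVneq (B (x - m)) 0; first by rewrite !mulr0 subr0.
by rewrite ln_div ?posrE// ?mulrBl// lt_neqAle eq_sym Bx B_ge0.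
Qed.

(** A finite divergence forces its integrand to be integrable. With finite entropy, the cross term
    is then almost everywhere a difference of two integrable functions, and the translation by [m]
    leaves the entropy unchanged. *)
Lemma KL_cross_entropy m (k : R) : KL (fun x => B (x - m)) alpha = k%:E ->
  (integrableR (fun y => B y * l (m + y))) *
  (\int[mu]_y (B y * l (m + y)) = - Ent B - k).
Proof.
move=> KLk.
have mkl : measurable_fun setT (fun x => ln (B (x - m) / alpha x) * B (x - m)).
  apply: measurable_funM => //; apply: measurableT_comp => //.
  exact: measurable_funM.
have ikl : integrableR (fun x => ln (B (x - m) / alpha x) * B (x - m)).
  by apply: integrableR_fin_num => //; move: KLk; rewrite /KL => ->.
have {}KLk : \int[mu]_x (ln (B (x - m) / alpha x) * B (x - m)) = k.
  by rewrite /Rintegral; move: KLk; rewrite /KL => ->.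
have mlB : measurable_fun setT (fun x => l x * B (x - m)) by exact: measurable_funM.
have E : {ae mu, forall x, ln (B (x - m)) * B (x - m) -
    ln (B (x - m) / alpha x) * B (x - m) = l x * B (x - m)}.
  by apply: aeS (KL_split m) => x ->; rewrite opprB addrC subrK.
have iD := integrableRB (ent_shift m) ikl.
have ilB : integrableR (fun x => l x * B (x - m)) by exact: integrableR_ae iD mlB E.
have VlB : \int[mu]_x (l x * B (x - m)) = - Ent B - k.
  rewrite -(Rintegral_ae (integrableR_measurable iD) mlB E).
  rewrite RintegralB; [|by []|exact: ent_shift|exact: ikl].
  rewrite KLk /Ent opprK; congr (_ - _).
  exact: (@Rintegral_shift _ (- m) (fun x => ln (B x) * B x)).
split.
  apply: integrableR_ext (integrableR_shift m ilB) => y.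
  by rewrite addrK mulrC addrC.
rewrite -VlB -(Rintegral_shift m ilB); apply: RintegralT_eq => y.
by rewrite addrK mulrC addrC.
Qed.

Hypothesis lB_int : forall m, integrableR (fun y => B y * l (m + y)).

(* [|l| = 2 max(l, 0) - l] and [max(l, 0) <= alpha], which has integral 1. *)
Lemma cross_entropy_norm M m : (forall x, `|B x| <= M) ->
  \int[mu]_y (B y * `|l (m + y)|) <= 2 * M + `|\int[mu]_y (B y * l (m + y))|.
Proof.
move=> BM; have [ia a1] := density_Rintegral prior_density.
have M0 : 0 <= M := le_trans (normr_ge0 _) (BM 0).
have iam : integrableR (fun y => alpha (m + y)).
  by apply: integrableR_ext (integrableR_shift m ia) => y; rewrite addrC.
have am : \int[mu]_y alpha (m + y) = 1.
  by rewrite -a1 -(Rintegral_shift m ia); apply: RintegralT_eq => y; rewrite addrC.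
apply: (@le_trans _ _ (\int[mu]_y (2 * M * alpha (m + y) - B y * l (m + y)))).
  apply: le_RintegralT.
  - apply: integrableR_ext (integrableR_norm (lB_int m)) => y.
    by rewrite normrM ger0_norm.
  - exact/integrableRB/lB_int/integrableRZl.
  move=> y; have lea : l (m + y) <= alpha (m + y).
    (* Where [alpha] vanishes, [ln] takes the default value 0 and the inequality persists. *)
    rewrite /l; have [|a0] := leP (alpha (m + y)) 0; first by move=> /ln0 ->.
    exact/ltW/ln_sublinear.
  have a0 := a_ge0 (m + y); have b0 := B_ge0 y.
  have bM : B y <= M := le_trans (ler_norm _) (BM y).
  rewrite lerBrDr -mulrDr.
  have H : `|l (m + y)| + l (m + y) <= 2 * alpha (m + y).
    by have [] := ger0P (l (m + y)); lra.
  apply: (le_trans (ler_wpM2l b0 H)); rewrite mulrCA -mulrA ler_wpM2l// ler_wpM2r//.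
rewrite RintegralB; [|by []|exact: integrableRZl|exact: lB_int].
rewrite RintegralZl// am mulr1 lerD2l.
by rewrite (le_trans (ler_norm _))// normrN.
Qed.

End cross_entropy.

(** * Quadratic functions integrated against a centred density *)

Section quadratic_moments.
Context {R : realType}.
Local Notation mu := (@lebesgue_measure R).
Implicit Types (x y m : R).

Variable B : R -> R.
Hypotheses (dB : density B) (mB : has_mean B 0) (rB : rapid B).

Definition second_moment := \int[mu]_y (y ^+ 2 * B y).

Let i0 := rapid_integrableR rB.
Let i1 : integrableR (fun y => y * B y) := rapid_integrableR (rapidX rB).
Let i2 : integrableR (fun y => y ^+ 2 * B y) := proj2 rB 2%N.

Let mean0 : \int[mu]_y (y * B y) = 0.
Proof. by rewrite /Rintegral; move: mB; rewrite /has_mean => ->. Qed.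

Lemma second_moment_ge0 : 0 <= second_moment.
Proof. by apply: Rintegral_ge0 => y _; rewrite mulr_ge0 ?sqr_ge0//; case: dB. Qed.

Lemma Var_second_moment : Var B = second_moment.
Proof.
by rewrite /Var /Mean mean0; apply: RintegralT_eq => y; rewrite subr0.
Qed.

(** The cross term 2 c2 m y integrates to zero because the mean is 0, so only even powers of [m]
    survive. The coefficients are free because the absolute values of [c0] and [c2] are also used in
    a growth bound. *)
Lemma quadratic_convolution c0 c2 m :
  integrableR (fun y => B y * (c0 + c2 * (m + y) ^+ 2)) /\
  \int[mu]_y (B y * (c0 + c2 * (m + y) ^+ 2)) =
  c0 + c2 * (second_moment + m ^+ 2).
Proof.
have E y : ((c0 + c2 * m ^+ 2) * B y + (2 * c2 * m) * (y * B y)) + c2 * (y ^+ 2 * B y)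
  = B y * (c0 + c2 * (m + y) ^+ 2) by ring.
have j0 := integrableRZl (c0 + c2 * m ^+ 2) i0.
have j1 := integrableRZl (2 * c2 * m) i1.
have j2 := integrableRZl c2 i2.
have j01 := integrableRD j0 j1.
split; first exact: integrableR_ext E (integrableRD j01 j2).
rewrite -(RintegralT_eq E) RintegralD// RintegralD// !RintegralZl//.
by rewrite (proj2 (density_Rintegral dB)) mean0 -/second_moment; ring.
Qed.

End quadratic_moments.

(** * Normalization of the exponential of a quadratic *)

Section gaussian.
Context {R : realType}.
Local Notation mu := (@lebesgue_measure R).
Implicit Types (x y : R).

Lemma exp_quadratic_density (c0 c2 : R) :
  \int[mu]_x expR (c0 + c2 * x ^+ 2) = 1 ->
  integrableR (fun x => expR (c0 + c2 * x ^+ 2)) ->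
  exists2 s : R, 0 < s & c2 = - (2 * s ^+ 2)^-1 /\
    expR c0 = (Num.sqrt (2 * pi * s ^+ 2))^-1.
Proof.
move=> I1 iE.
have c2_lt0 : c2 < 0.
  rewrite ltNge; apply/negP => c2_ge0.
  have e0 : 0 < expR c0 := expR_gt0 c0.
  (* If c2 >= 0 the integrand is at least exp(c0), so its integral over [0, N] is already at least
     2. *)
  pose N := 2 / expR c0; have N0 : 0 < N by rewrite divr_gt0.
  have i1 : integrableR (\1_`[0, N] : R -> R) by exact: integrable_indic_itv.
  have : \int[mu]_x (expR c0 * \1_`[0, N] x) <= 1.
    rewrite -I1; apply: le_RintegralT => //; first exact: integrableRZl.
    move=> x; rewrite indicE; case: (_ \in _); last by rewrite mulr0 expR_ge0.
    by rewrite mulr1 ler_expR lerDl mulr_ge0// sqr_ge0.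
  rewrite RintegralZl// /Rintegral integral_indic//= setIT.
  rewrite lebesgue_measure_itv/= lte_fin N0 oppr0 addr0 /N mulrCA mulfV ?gt_eqF//.
  lra.
(* [v] is the variance, read off from c2 = -1 / (2 v). *)
pose v := - (2 * c2)^-1.
have v0 : 0 < v by rewrite oppr_gt0 invr_lt0 pmulr_rlt0.
exists (Num.sqrt v); first by rewrite sqrtr_gt0.
have sv : Num.sqrt v ^+ 2 = v by rewrite sqr_sqrtr// ltW.
rewrite sv.
have c2E : c2 = - (2 * v)^-1.
  by rewrite /v; field; rewrite ?oppr_eq0 lt_eqF.
split=> //.
have s0 : Num.sqrt v != 0 by rewrite gt_eqF// sqrtr_gt0.
have pk : normal_peak (Num.sqrt v) = (Num.sqrt (2 * pi * v))^-1.
  by rewrite /normal_peak sv; congr (Num.sqrt _)^-1; ring.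
rewrite -pk; have p0 := normal_peak_gt0 s0.
(* A multiple of the normal density with the same total mass 1: the factor is 1, which determines
   [c0]. *)
have E x : expR (c0 + c2 * x ^+ 2) =
   expR c0 * (normal_peak (Num.sqrt v))^-1 * normal_pdf 0 (Num.sqrt v) x.
  transitivity (expR c0 * normal_fun 0 (Num.sqrt v) x); last first.
    by rewrite normal_pdfE//=; field; rewrite gt_eqF.
  rewrite /normal_fun expRD; congr (_ * expR _).
  by rewrite subr0 sv c2E -mulr_natl; field; rewrite gt_eqF.
move: I1; rewrite (RintegralT_eq E) RintegralZl//; last exact: integrable_normal_pdf.
rewrite /Rintegral integral_normal_pdf /= mulr1 => /(canRL (mulfVK _)) ->.
  by rewrite mul1r.
by rewrite gt_eqF.
Qed.

End gaussian.

(** * Identification of the prior and of the penalty *)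

Section main.
Context {R : realType}.
Local Notation mu := (@lebesgue_measure R).

Lemma continuous_locally_integrable (f : R -> R) : continuous f ->
  locally_integrable setT f.
Proof.
move=> cf; split => [||K _ cK].
- exact: continuous_measurable_fun.
- exact: openT.
- have /integrableP[_] := continuous_compact_integrable cK (continuous_subspaceT cf).
  by [].
Qed.

Lemma ln_quadratic (B alpha : R -> R) (a b K : R) :
  density B -> has_mean B 0 -> schwartz (toC B) -> finite_entropy B ->
  (forall xi, fourier (toC B) xi <> 0) -> prior alpha ->
  (forall m, KL (fun x => B (x - m)) alpha = (a + 2^-1 * b * m ^+ 2 + K)%:E) ->
  exists c0 c2, {ae mu, forall x, ln (alpha x) = c0 + c2 * x ^+ 2}.
Proof.
move=> dB mB sB eB fB pa KLm; have rB := schwartz_toC_rapid sB.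
have lB m := KL_cross_entropy dB eB pa (KLm m).
(* The coefficients solve - Ent B - (a + b m^2 / 2 + K) = c0 + c2 (V + m^2) for all [m]. *)
pose V := second_moment B; pose c2 := - (b / 2).
pose c0 := - Ent B - a - K + b / 2 * V.
exists c0, c2.
have [M HM] := schwartz_toC_bound 0 sB.
have {}HM x : `|B x| <= M by have := HM x; rewrite mul1r.
have M0 : 0 <= M := le_trans (normr_ge0 _) (HM 0).
have V0 : 0 <= V := second_moment_ge0 dB.
have B0 x : 0 <= B x by case: dB.
pose q x := c0 + c2 * x ^+ 2.
have qB := quadratic_convolution dB mB rB c0 c2.
pose h x := ln (alpha x) - q x.
suff : {ae mu, forall x, h x = 0}.
  by apply: aeS => x /eqP; rewrite subr_eq0 => /eqP.
have [y0 By0] : exists y0, 0 < B y0.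
  apply: contrapT => /forallNP NB; have [_ I1] := density_Rintegral dB.
  move: I1; rewrite (@RintegralT_eq _ _ (fun=> 0)) ?Rintegral_cst ?mul0r//.
    by move/eqP; rewrite eq_sym oner_eq0.
  by move=> x; apply/eqP; rewrite eq_le B0 andbT leNgt; apply/negP; exact: NB.
have cq : continuous q.
  have := CnD (Cn_cst 0 c0) (CnM (Cn_cst 0 c2) (CnM (Cn_affine 0 1 0) (Cn_affine 0 1 0))).
  suff -> : (fun x => c0 + c2 * ((1 * x + 0) * (1 * x + 0))) = q by [].
  by apply/funext => x; rewrite /q; ring.
have hE x y : B y * h (x + y) = B y * ln (alpha (x + y)) - B y * (c0 + c2 * (x + y) ^+ 2).
  by rewrite mulrBr.
(* Crude sum of the constants in the triangle inequality: [cross_entropy_norm] bounds the part of ln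
   alpha, and the integral of B |q| is at most |c0| + |c2| (V + x^2). *)
pose D := 2 * M + `|Ent B + a + K| + `|b| + `|c0| + `|c2| * V + `|c2|.
apply: (@convolution_injective R h B D y0) => //.
- have [_ _ [ll _]] := pa.
  exact: locally_integrableB ll (continuous_locally_integrable cq).
- exact: schwartz_toC_continuous.
- move=> x; apply: fourier_toC_neq0 => //; exact: rapid_integrableR.
- move=> x; apply: integrableR_ext (fun y => esym (hE x y)) _.
  exact: integrableRB (lB x).1 (qB x).1.
- move=> x.
  have iql : integrableR (fun y => B y * `|ln (alpha (x + y))|).
    apply: integrableR_ext (integrableR_norm (lB x).1) => y.
    by rewrite normrM ger0_norm.
  have [iq1 Eq1] := quadratic_convolution dB mB rB `|c0| `|c2| x.
  apply: (@le_trans _ _ (\int[mu]_y (B y * `|ln (alpha (x + y))| +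
       B y * (`|c0| + `|c2| * (x + y) ^+ 2)))).
    apply: le_RintegralT.
    + apply: integrableR_ext (integrableR_norm (integrableRB (lB x).1 (qB x).1)) => y.
      by rewrite -hE normrM ger0_norm.
    + exact: integrableRD.
    move=> y; rewrite -mulrDr ler_wpM2l//; apply: (le_trans (ler_normB _ _)).
    rewrite lerD2l; apply: (le_trans (ler_normD _ _)).
    by rewrite lerD2l normrM (ger0_norm (sqr_ge0 _)).
  rewrite RintegralD// Eq1 -/V.
  have H := cross_entropy_norm dB pa (fun m => (lB m).1) x HM.
  apply: (le_trans (lerD H (lexx _))); rewrite (lB x).2 /D /jweight -expr2.
  have -> : - Ent B - (a + 2^-1 * b * x ^+ 2 + K) =
    - (Ent B + a + K) - 2^-1 * b * x ^+ 2 by ring.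
  have N : `|- (Ent B + a + K) - 2^-1 * b * x ^+ 2| <=
     `|Ent B + a + K| + 2^-1 * (`|b| * x ^+ 2).
    apply: (le_trans (ler_normB _ _)); rewrite normrN lerD2l.
    have h2 : 0 <= (2^-1 : R) by rewrite invr_ge0.
    by rewrite -mulrA normrM (ger0_norm h2) normrM (ger0_norm (sqr_ge0 x)).
  have x2 : 0 <= x ^+ 2 := sqr_ge0 x.
  have p1 := mulr_ge0 (normr_ge0 b) x2.
  have p2 := mulr_ge0 (normr_ge0 (Ent B + a + K)) x2.
  have p3 := mulr_ge0 (normr_ge0 c0) x2.
  have p4 := mulr_ge0 (mulr_ge0 (normr_ge0 c2) V0) x2.
  have p5 := mulr_ge0 M0 x2.
  have p6 := normr_ge0 b; have p7 := normr_ge0 c2.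
  move: N; set Y := x ^+ 2 in x2 p1 p2 p3 p4 p5 *; lra.
- move=> x; rewrite (RintegralT_eq (hE x)).
  rewrite RintegralB; [|by []|exact: (lB x).1|exact: (qB x).1].
  by rewrite (lB x).2 (qB x).2 -/V /c0 /c2; field.
Qed.

(** Shifting both integrals returns to the variable in which [f] and [g] agree outside a null
    set. *)
Lemma Rintegral_convolution_ae (w f g : R -> R) m :
  {ae mu, forall x, f x = g x} ->
  integrableR (fun y => w y * f (m + y)) ->
  integrableR (fun y => w y * g (m + y)) ->
  \int[mu]_y (w y * f (m + y)) = \int[mu]_y (w y * g (m + y)).
Proof.
move=> fg iF iG; rewrite -(Rintegral_shift (- m) iF) -(Rintegral_shift (- m) iG).
apply: Rintegral_ae.
- exact: integrableR_measurable (integrableR_shift (- m) iF).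
- exact: integrableR_measurable (integrableR_shift (- m) iG).
- by apply: aeS fg => x; rewrite (addrC m) subrK => ->.
Qed.

End main.

Theorem corollary4 (R : realType) (k : nat) (Nu : set 'rV[R]_k)
    (Nu_nonempty : Nu !=set0)
    (beta : R -> 'rV[R]_k -> R -> R)
    (beta_density : forall (mu : R) (nu : 'rV[R]_k), Nu nu ->
       density (beta mu nu) /\ has_mean (beta mu nu) mu)
    (a b : 'rV[R]_k -> R)
    (ha : translation_invariant Nu beta)
    (hb : forall nu : 'rV[R]_k, Nu nu ->
       finite_entropy (beta 0 nu) /\ schwartz (toC (beta 0 nu)))
    (hc : forall (nu : 'rV[R]_k) (xi : R), Nu nu ->
       fourier (toC (beta 0 nu)) xi <> 0)
    (hi : forall nu : 'rV[R]_k, Nu nu -> fun_in_Sprime (penalty a b nu))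
    (hii : forall nu : 'rV[R]_k, Nu nu ->
       in_Sprime (fourier_quotient (beta 0 nu) (penalty a b nu)))
    (hiii : forall nu nu' : 'rV[R]_k, Nu nu -> Nu nu' ->
       dist_eq (A_dist (beta 0 nu) (penalty a b nu))
               (A_dist (beta 0 nu') (penalty a b nu')))
    (hiv : forall nu : 'rV[R]_k, Nu nu ->
       exp_integrable (A_dist (beta 0 nu) (penalty a b nu)))
    (alpha : R -> R) (alpha_prior : prior alpha)
    (hKL : corresponds_to_KL Nu beta (penalty a b) alpha) :
  exists sigma0 : R,
    [/\ 0 < sigma0,
        (exists K : R, forall (nu : 'rV[R]_k) (mu : R), Nu nu ->
           penalty a b nu mu + K =
             (Var (beta 0 nu) + mu ^+ 2) / (2 * sigma0 ^+ 2)
             - Ent (beta 0 nu)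
             + 2^-1 * ln (2 * pi * expR 1 * sigma0 ^+ 2)) &
        {ae @lebesgue_measure R, forall theta : R,
           alpha theta = (Num.sqrt (2 * pi * sigma0 ^+ 2))^-1
             * expR (- (theta ^+ 2 / (2 * sigma0 ^+ 2)))}].
Proof.
case: Nu_nonempty => nu0 Nnu0; case: hKL => K HK.
have KLs nu m : Nu nu ->
    KL (fun x => beta 0 nu (x - m)) alpha = (penalty a b nu m + K)%:E.
  move=> Nnu; have <- : beta m nu = (fun x => beta 0 nu (x - m)).
    by apply/funext => x; exact: ha.
  by rewrite (HK m nu Nnu).
(* A single parameter [nu0] determines the prior, which does not vary with [nu]; the other
   parameters are then read from it. *)
have [c0 [c2 lnq]] : exists c0 c2,
    {ae @lebesgue_measure R, forall x, ln (alpha x) = c0 + c2 * x ^+ 2}.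
  have [dB mB] := beta_density 0 nu0 Nnu0; have [eB sB] := hb nu0 Nnu0.
  apply: (ln_quadratic dB mB sB eB (fun xi => hc nu0 xi Nnu0) alpha_prior
    (K := K) (a := a nu0) (b := b nu0)).
  by move=> m; exact: KLs.
have aE : {ae @lebesgue_measure R, forall x, alpha x = expR (c0 + c2 * x ^+ 2)}.
  have [_ a0 _] := alpha_prior; apply: aeS2 a0 lnq => x ax <-.
  by rewrite lnK.
have [ia a1] := density_Rintegral (prior_density alpha_prior).
have mq : measurable_fun setT (fun x : R => expR (c0 + c2 * x ^+ 2)).
  apply: measurableT_comp => //; apply: measurable_funD => //.
  by apply: measurable_funM => //; exact: measurable_funX.
have iq := integrableR_ae ia mq aE.
have := a1; rewrite (Rintegral_ae (integrableR_measurable ia) mq aE) => q1.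
have [s s0 [c2E c0E]] := exp_quadratic_density q1 iq.
exists s; split=> //; last first.
  by apply: aeS aE => x ->; rewrite expRD c0E c2E; congr (_ * expR _); ring.
(* The 1/2 is the contribution of [expR 1] inside the logarithm of the target formula. *)
exists (K + 2^-1) => nu m Nnu.
have [dB mB] := beta_density 0 nu Nnu; have [eB sB] := hb nu Nnu.
have rB := schwartz_toC_rapid sB.
have [iB EB] := KL_cross_entropy dB eB alpha_prior (KLs nu m Nnu).
have [iQ EQ] := quadratic_convolution dB mB rB c0 c2 m.
(* The cross entropy for this [nu], computed from the divergence and from the quadratic, gives the
   penalty. *)
have := Rintegral_convolution_ae lnq iB iQ; rewrite {}EB {}EQ.
rewrite -(Var_second_moment mB) => E.
have c0_ln : c0 = - (2^-1 * ln (2 * pi * s ^+ 2)).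
  rewrite -[c0]expRK c0E.
  have p0 : 0 < 2 * pi * s ^+ 2 by rewrite !mulr_gt0 ?pi_gt0// exprn_gt0.
  rewrite lnV ?posrE ?sqrtr_gt0//; congr (- _).
  have := @lnXn R 2 (Num.sqrt (2 * pi * s ^+ 2)).
  by rewrite sqrtr_gt0 sqr_sqrtr ?ltW// => /(_ p0) ->; rewrite mulr2n; field.
have -> : ln (2 * pi * expR 1 * s ^+ 2) = 1 + ln (2 * pi * s ^+ 2).
  have -> : 2 * pi * expR 1 * s ^+ 2 = expR 1 * (2 * pi * s ^+ 2) by ring.
  by rewrite lnM ?posrE ?expR_gt0 ?expRK// !mulr_gt0 ?pi_gt0// exprn_gt0.
have -> : penalty a b nu m + (K + 2^-1) =
  - Ent (beta 0 nu) - (- Ent (beta 0 nu) - (penalty a b nu m + K)) + 2^-1 by ring.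
by rewrite E c0_ln c2E; ring.
Qed.
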